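(* Consider the Lagrangian $$\mathcal{L}=\int_{\mathbb{R}}\Big(\tfrac12\big(iu_tu^*-iuu_t^*\big)+h(u,u_x,u^*,u_x^* )\Big)\,\mathrm{d}x ,$$ where the map $h$ satisfies $\left(\frac{\partial h}{\partial u}\right)^*=\frac{\partial h}{\partial u^*}$, and the PDE $$\frac{\partial u}{\partial t}=F(u):=-i\,\frac{\partial}{\partial x}\frac{\partial h}{\partial u_x^*}+i\,\frac{\partial h}{\partial u^*},$$ to which the first variation of the corresponding action functional $\int\mathcal{L}\,\mathrm{d}t$ leads. Let $\hat u(x,\mathbf{q}(t))$ be a sufficiently smooth ansatz and assume, furthermore, that it has the form $$\hat u(x,\mathbf{q}(t))=\phi\Big(\sum_{j=0}^m z_j(t)\,x^j\Big),$$ where $z_j=\alpha_j+i\beta_j$, $\mathbf{q}=(\alpha_0,\dots,\alpha_m,\beta_0,\dots,\beta_m)$ and $\phi:\mathbb{C}\to\mathbb{C}$ is a sufficiently smooth map. Then the reduced-order equations produced by the reduced Lagrangian approach and by RONS coincide.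
   Context: Notation: $^*$ denotes complex conjugation. In derivatives of $h$, the variables $u,u^*,u_x,u_x^*$ are treated as independent. The solution $u$ is complex-valued, with $x\in\mathbb{R}$ and $t\ge 0$. Put $n=2(m+1)$ and write $\mathbf{q}=(q_1,\dots,q_n)$; the parameters $\mathbf{q}(t)$ take values in a set $\Omega\subseteq\mathbb{R}^n$ (so $\alpha_j,\beta_j$ are real), and $\dot{\mathbf{q}}\in\mathbb{R}^n$. Hilbert space: $H$ is the space of complex square-integrable functions on $\mathbb{R}$ with inner product $\langle f,g\rangle_H=\int_{\mathbb{R}}f\,g^*\,\mathrm{d}x$ and norm $\|\cdot\|_H$; the ansatz maps parameters to elements $\hat u(\cdot,\mathbf{q})$ of $H$. RONS (reduced-order nonlinear solutions), without enforced conserved quantities: for given $\mathbf{q}$, $\dot{\mathbf{q}}$ is chosen to minimize the instantaneous error $\mathcal{J}(\mathbf{q},\dot{\mathbf{q}})=\frac12\|\hat u_t-F(\hat u)\|_H^2$ over $\dot{\mathbf{q}}\in\mathbb{R}^n$, where $\hat u_t=\sum_{j=1}^n\frac{\partial\hat u}{\partial q_j}\dot q_j$. The resulting reduced-order equation is $\dot{\mathbf{q}}=(\mathrm{Re}[M])^{-1}\mathrm{Re}[\mathbf{f}]$, where $M_{kj}=\langle\frac{\partial\hat u}{\partial q_k},\frac{\partial\hat u}{\partial q_j}\rangle_H$ is the metric tensor, which is Hermitian positive definite, and $f_k=\langle\frac{\partial\hat u}{\partial q_k},F(\hat u)\rangle_H$. Reduced Lagrangian approach: substitute the ansatz $\hat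 u(x,\mathbf{q}(t))$ into $\mathcal{L}$ and integrate over $x$ to obtain the reduced Lagrangian $\hat{\mathcal{L}}(\mathbf{q},\dot{\mathbf{q}})$. The reduced-order equations are the classical Euler--Lagrange equations $\frac{\partial\hat{\mathcal{L}}}{\partial q_k}-\frac{\mathrm{d}}{\mathrm{d}t}\frac{\partial\hat{\mathcal{L}}}{\partial\dot q_k}=0$, $k=1,\dots,n$. ''Coincide'' means equality as systems of equations for $\dot{\mathbf{q}}$ (up to equivalent rewriting, such as reordering the equations or multiplying them by nonzero constants).
   Formalization: ''Sufficiently smooth'' φ is read as twice continuously complex differentiable (the claim fails for merely real-smooth φ), and the first variation is required to give the PDE for variations of both u and u^* (true for real h; the claim fails for h = i|u_x|^2). *)

(* Defs.v *)
From HB Require Import structures.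
From mathcomp Require Import all_boot all_order all_algebra.
From mathcomp Require Import all_classical all_reals all_analysis.
Set Implicit Arguments.
Unset Strict Implicit.
Unset Printing Implicit Defensive.
Import Order.TTheory GRing.Theory Num.Theory.
Import numFieldNormedType.Exports.
From mathcomp Require Import complex.
Local Open Scope ring_scope.
Local Open Scope classical_set_scope.
Local Open Scope complex_scope.

Notation normc := ComplexField.Normc.normc.

Section Calculus.
Context {R : realType}.
Local Notation C := R[i].

(* R[i] is not a normed R-module in the library: complex-valued functions of
   real variables are differentiated and integrated componentwise. *)
Definition cderive (f : R -> C) (x : R) : C :=
  (fun y => Re (f y))^`() x +i* (fun y => Im (f y))^`() x.

Definition cpartial n (k : 'I_n) (f : 'rV[R]_n -> C) (a : 'rV[R]_n) : C :=
  'D_(delta_mx 0 k) (fun b => Re (f b)) a +i*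
  'D_(delta_mx 0 k) (fun b => Im (f b)) a.

Definition cintegral (f : R -> C) : C :=
  (\int[lebesgue_measure]_(x in setT) Re (f x)) +i*
  (\int[lebesgue_measure]_(x in setT) Im (f x)).

(* Wirtinger derivatives: d/dz and d/dz^* for a real-differentiable f, the
   meaning of differentiating with z and z^* treated as independent. *)
Definition wirt (f : C -> C) (z : C) : C :=
  2^-1 * (cderive (fun s => f (z + s%:C)) 0
          - 'i * cderive (fun s => f (z + 'i * s%:C)) 0).

Definition wirt_bar (f : C -> C) (z : C) : C :=
  2^-1 * (cderive (fun s => f (z + s%:C)) 0
          + 'i * cderive (fun s => f (z + 'i * s%:C)) 0).

Fixpoint Ck n (k : nat) (f : 'rV[R]_n -> R) : Prop :=
  continuous f /\
  if k is k'.+1 then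
    forall i : 'I_n, (forall a, derivable f a (delta_mx 0 i)) /\
                     Ck k' (fun a => 'D_(delta_mx 0 i) f a)
  else True.

(* Twice continuously differentiable in the complex sense. *)
Definition complex_C2 (phi : C -> C) : Prop :=
  let phi : C^o -> C^o := phi in
  [/\ forall z, derivable phi z 1,
      forall z, derivable phi^`() z 1 &
      continuous (derive1n 2 phi)].

Definition in_H (f : R -> C) : Prop :=
  [/\ measurable_fun setT (fun x => Re (f x)),
      measurable_fun setT (fun x => Im (f x)) &
      lebesgue_measure.-integrable setT (fun x => (normc (f x) ^+ 2)%:E)].

Definition inner (f g : R -> C) : C := cintegral (fun x => f x * (g x)^*).

Definition normH (f : R -> C) : R := Num.sqrt (Re (inner f f)).

End Calculus.

Section Lagrangian.
Context {R : realType}.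
Local Notation C := R[i].

(* h u p, with p = u_x, is the value of h at (u, u_x) and their conjugates: as
   a function of two complex variables it is only smooth in the real sense, and
   its derivatives are Wirtinger derivatives. *)
Variable h : C -> C -> C.

Definition real_C2 : Prop :=
  let hR (y : 'rV[R]_4) :=
    h (y 0 (inord 0) +i* y 0 (inord 1)) (y 0 (inord 2) +i* y 0 (inord 3)) in
  Ck 2 (fun y => Re (hR y)) /\ Ck 2 (fun y => Im (hR y)).

Definition h_u (u p : C) : C := wirt (fun z => h z p) u.
Definition h_ubar (u p : C) : C := wirt_bar (fun z => h z p) u.
Definition h_p (u p : C) : C := wirt (fun z => h u z) p.
Definition h_pbar (u p : C) : C := wirt_bar (fun z => h u z) p.

Definition F (w : R -> C) (x : R) : C :=
  - 'i * cderive (fun y => h_pbar (w y) (cderive w y)) x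
  + 'i * h_ubar (w x) (cderive w x).

(* u, p, v stand for u, u_x, u_t. *)
Definition density (u p v : C) : C :=
  2^-1 * ('i * v * u^* - 'i * u * v^*) + h u p.

Section Variation.
(* w takes x, then t. *)
Variable w : R -> R -> C.
Let w_x (x t : R) : C := cderive (fun y => w y t) x.
Let w_t (x t : R) : C := cderive (fun s => w x s) t.

(* The functional derivatives of the action with respect to u and u^*, taken as
   independent; D is the Wirtinger derivative in use. *)
Let variation (D : (C -> C) -> C -> C) (x t : R) : C :=
  D (fun u => density u (w_x x t) (w_t x t)) (w x t)
  - cderive (fun s => D (fun v => density (w x s) (w_x x s) v) (w_t x s)) t
  - cderive (fun y => D (fun p => density (w y t) p (w_t y t)) (w_x y t)) x.

Definition variation_u := variation wirt.
Definition variation_ubar := variation wirt_bar.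

Definition C2_field : Prop :=
  let wR (y : 'rV[R]_2) := w (y 0 (inord 0)) (y 0 (inord 1)) in
  Ck 2 (fun y => Re (wR y)) /\ Ck 2 (fun y => Im (wR y)).
End Variation.

(* Both Euler-Lagrange equations of the action, for variations of u and of
   u^*, are the PDE u_t = F(u). Without reality of h in u_x they may disagree:
   for h = i |u_x|^2 they are u_t = - u_xx and u_t = u_xx. *)
Definition first_variation_is_pde : Prop :=
  forall w : R -> R -> C, C2_field w -> forall x t : R,
    (variation_u w x t = 0 <->
       cderive (fun s => w x s) t = F (fun y => w y t) x) /\
    (variation_ubar w x t = 0 <->
       cderive (fun s => w x s) t = F (fun y => w y t) x).

Section Reduction.
Variables (n : nat) (uhat : 'rV[R]_n -> R -> C).

Definition du (k : 'I_n) (q : 'rV[R]_n) (x : R) : C :=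
  cpartial k (fun p => uhat p x) q.

Definition uhat_t (q v : 'rV[R]_n) (x : R) : C :=
  \sum_(j < n) du j q x * (v 0 j)%:C.

Definition metric (q : 'rV[R]_n) : 'M[C]_n :=
  \matrix_(k, j) inner (du k q) (du j q).

Definition rhs (q : 'rV[R]_n) : 'cV[C]_n :=
  \col_k inner (du k q) (F (uhat q)).

Definition error (q v : 'rV[R]_n) : R :=
  2^-1 * normH (fun x => uhat_t q v x - F (uhat q) x) ^+ 2.

Definition rons_minimizer (q v : 'rV[R]_n) : Prop :=
  forall w : 'rV[R]_n, error q v <= error q w.

Definition rons_equation (q v : 'rV[R]_n) : Prop :=
  v^T = invmx (map_mx (@Re R) (metric q)) *m map_mx (@Re R) (rhs q).

Definition reduced_lagrangian (q v : 'rV[R]_n) : C :=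
  cintegral (fun x =>
    density (uhat q x) (cderive (uhat q) x) (uhat_t q v x)).

Definition euler_lagrange (q : R -> 'rV[R]_n) (t : R) : Prop :=
  forall k : 'I_n,
    cpartial k (fun a => reduced_lagrangian a (derive1 q t)) (q t)
    - cderive (fun s =>
        cpartial k (fun v => reduced_lagrangian (q s) v) (derive1 q s)) t = 0.

(* v ranges over real vectors, as velocities do. Positivity over complex
   vectors would ask for tangent vectors independent over C, which fails
   whenever the tangent space is stable under multiplication by i. *)
Definition metric_posdef (Omega : set 'rV[R]_n) : Prop :=
  forall q, Omega q -> forall v : 'rV[R]_n, v != 0 ->
    0 < (v *m map_mx (@Re R) (metric q) *m v^T) 0 0.

(* The smoothness and decay that allow one to differentiate the reduced
   Lagrangian under the integral sign and to integrate by parts in x. *)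
Definition regular_ansatz (Omega : set 'rV[R]_n) : Prop :=
  [/\ forall q, Omega q -> in_H (uhat q) /\ in_H (F (uhat q)),
      forall q0, Omega q0 -> exists g : R -> R,
        lebesgue_measure.-integrable setT (EFin \o g) /\
        \forall q \near q0, forall x : R,
          [/\ normc (uhat q x) ^+ 2 <= g x,
              forall k, normc (du k q x) ^+ 2 <= g x,
              forall j k, normc (cpartial j (fun p => du k p x) q) ^+ 2 <= g x,
              normc (h (uhat q x) (cderive (uhat q) x)) <= g x &
              forall k,
                normc (cpartial k
                  (fun p => h (uhat p x) (cderive (uhat p) x)) q) <= g x],
      forall q k, Omega q ->
        let b x := h_p (uhat q x) (cderive (uhat q) x) * du k q x in
        (normc (b x) @[x --> +oo] --> 0) /\ (normc (b x) @[x --> -oo] --> 0) &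
      forall q k, Omega q ->
        let b x := h_pbar (uhat q x) (cderive (uhat q) x) * (du k q x)^* in
        (normc (b x) @[x --> +oo] --> 0) /\ (normc (b x) @[x --> -oo] --> 0)].

End Reduction.
End Lagrangian.

(* q = (alpha_0, ..., alpha_m, beta_0, ..., beta_m). *)
Definition poly_ansatz {R : realType} (m : nat) (phi : R[i] -> R[i])
    (q : 'rV[R]_(m.+1 + m.+1)) (x : R) : R[i] :=
  phi (\sum_(j < m.+1)
    (q 0 (lshift m.+1 j) +i* q 0 (rshift m.+1 j)) * (x ^+ j)%:C).

(* Main.v *)
Require Import Defs.
From HB Require Import structures.
From mathcomp Require Import all_boot all_order all_algebra.
From mathcomp Require Import all_classical all_reals all_analysis.
Set Implicit Arguments.
Unset Strict Implicit.
Unset Printing Implicit Defensive.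
Import Order.TTheory GRing.Theory Num.Theory.
Import numFieldNormedType.Exports.
From mathcomp Require Import complex.
From mathcomp Require Import measurable_realfun ring lra.
Local Open Scope ring_scope.
Local Open Scope classical_set_scope.
Local Open Scope complex_scope.

(** Let [W = uhat_t] be the velocity of the ansatz, [T_k] its derivative in the
    [k]-th parameter, and [<.,.>] the inner product of [H]. The function
    minimized by the reduced-order method is the squared distance from [W], a
    real combination of the [T_k], to [F uhat]; the minimizers are the solutions
    of the normal equations [Re <T_k, W - F uhat> = 0], which are the equations
    inverted by the matrix [Re M] ([least_squares], [rons_equation_residual],
    [rons_minimizer_residual]).

    The reduced Lagrangian is affine in the velocity. The coefficient of the
    [k]-th velocity is a momentum that depends on the position alone, and when the
    Euler-Lagrange equation is expanded the symmetric second derivatives of the ansatz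
    cancel and leave [2 Im <T_k, W>] ([kinetic_diff_antisym]). The derivative of
    the energy [int h], integrated by parts, is [- 2 Im <T_k, F uhat>]
    ([cintegral_energy_variation]). So the Euler-Lagrange equations are
    [Im <T_k, W - F uhat> = 0] ([euler_lagrange_residual]).

    Integration by parts produces [h_u - (h_p)_x] next to [h_ubar - (h_pbar)_x].
    The second is [- i F] by definition of [F]; that the first is its conjugate
    follows from [h_ubar = h_u^*] and from the two variations of the action giving
    one and the same PDE. Testing them on fields [w x + t c] with a free constant velocity
    [c] shows that [(h_p)_x] and [(h_pbar)_x] are conjugate ([flux_conj]).

    Finally [phi] is holomorphic, so the derivatives in [beta_j] and in [alpha_j]
    satisfy [T_(beta_j) = i T_(alpha_j)]. The tangent space is stable under
    multiplication by [i], which turns imaginary parts into real parts, and the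
    two systems coincide ([residual_Re_Im]).

    The derivatives of the momenta along [q] require a chain rule for functions
    with continuous partial derivatives ([is_derive_curve]); those partial
    derivatives, and their continuity, come from dominated convergence. *)

(** * Complex-valued functions by components *)

Section ComplexComponents.
Context {R : realType}.
Local Notation C := R[i].
Implicit Types x y : C.

Lemma complex_eq x y : Re x = Re y -> Im x = Im y -> x = y.
Proof. by case: x => a b; case: y => c d /= -> ->. Qed.

Lemma Re_add x y : Re (x + y) = Re x + Re y. Proof. by case: x; case: y. Qed.
Lemma Im_add x y : Im (x + y) = Im x + Im y. Proof. by case: x; case: y. Qed.
Lemma Re_opp x : Re (- x) = - Re x. Proof. by case: x. Qed.
Lemma Im_opp x : Im (- x) = - Im x. Proof. by case: x. Qed.
Lemma Re_mul x y : Re (x * y) = Re x * Re y - Im x * Im y.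
Proof. by case: x; case: y. Qed.
Lemma Im_mul x y : Im (x * y) = Re x * Im y + Im x * Re y.
Proof. by case: x; case: y. Qed.
Lemma Re_conjc x : Re x^* = Re x. Proof. by case: x. Qed.
Lemma Im_conjc x : Im x^* = - Im x. Proof. by case: x. Qed.

Lemma Re_real_mul (r : R) x : Re (r%:C * x) = r * Re x.
Proof. by rewrite Re_mul /= mul0r subr0. Qed.

Lemma Im_real_mul (r : R) x : Im (r%:C * x) = r * Im x.
Proof. by rewrite Im_mul /= mul0r addr0. Qed.

Lemma complex_lin4 (a b c d : R) (x y z w : C) :
  a%:C * x + b%:C * y + c%:C * z + d%:C * w =
  (a * Re x + b * Re y + c * Re z + d * Re w) +i*
  (a * Im x + b * Im y + c * Im z + d * Im w).
Proof. by apply: complex_eq; rewrite ?Re_add ?Im_add ?Re_real_mul ?Im_real_mul. Qed.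

Lemma half_complex : 2^-1 = (2^-1)%:C :> C.
Proof. by rewrite fmorphV rmorphD rmorph1. Qed.

Definition componentE :=
  (Re_add, Im_add, Re_opp, Im_opp, Re_mul, Im_mul, Re_conjc, Im_conjc, half_complex).

Lemma Re_sum (I : Type) (s : seq I) (P : pred I) (f : I -> C) :
  Re (\sum_(i <- s | P i) f i) = \sum_(i <- s | P i) Re (f i).
Proof. by elim/big_rec2 : _ => //= i a b _ <-; rewrite Re_add. Qed.

Lemma Im_sum (I : Type) (s : seq I) (P : pred I) (f : I -> C) :
  Im (\sum_(i <- s | P i) f i) = \sum_(i <- s | P i) Im (f i).
Proof. by elim/big_rec2 : _ => //= i a b _ <-; rewrite Im_add. Qed.

Lemma normc_sqr x : normc x ^+ 2 = Re x ^+ 2 + Im x ^+ 2.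
Proof. by case: x => a b /=; rewrite sqr_sqrtr// addr_ge0// sqr_ge0. Qed.

Lemma normc_ge0 x : 0 <= normc x.
Proof. by case: x => a b; rewrite /= sqrtr_ge0. Qed.

Lemma le_Re_normc x : `|Re x| <= normc x.
Proof.
by case: x => a b /=; rewrite -sqrtr_sqr ler_wsqrtr// lerDl sqr_ge0.
Qed.

Lemma le_Im_normc x : `|Im x| <= normc x.
Proof.
by case: x => a b /=; rewrite -sqrtr_sqr ler_wsqrtr// lerDr sqr_ge0.
Qed.

Lemma le_normc_ReIm x : normc x <= `|Re x| + `|Im x|.
Proof.
rewrite -ler_sqr ?nnegrE ?normc_ge0 ?addr_ge0//.
rewrite normc_sqr sqrrD !real_normK ?num_real// lerD2r lerDl.
by rewrite mulrn_wge0// mulr_ge0.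
Qed.

Lemma normr_complex x : `|x| = (normc x)%:C. Proof. by case: x. Qed.

End ComplexComponents.

Section ComplexContinuity.
Context {R : realType}.
Local Notation C := R[i].

(** Continuity read on components, the form in which derivatives and integrals
    of complex-valued functions are taken. *)
Definition ccont (T : topologicalType) (f : T -> C) (x : T) : Prop :=
  {for x, continuous (fun y => Re (f y))} /\
  {for x, continuous (fun y => Im (f y))}.

Lemma ccontP (T : topologicalType) (f : T -> C^o) (x : T) :
  {for x, continuous f} <-> ccont f x.
Proof.
split=> [cf|[cr ci]].
  have H e : 0 < e -> \forall y \near x, normc (f x - f y) < e.
    move=> e0; move/cvgrPdist_lt : cf => /(_ e%:C).
    rewrite ltcR => /(_ e0); apply: filterS => y.
    by rewrite normr_complex ltcR.
  by split; apply/cvgrPdist_lt => e /H; apply: filterS => y /=;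
    apply: le_lt_trans; rewrite -?Re_opp -?Re_add -?Im_opp -?Im_add
      ?le_Re_normc ?le_Im_normc.
apply/cvgrPdist_lt => -[e e'] /=; rewrite ltcE/= => /andP[/eqP -> e0].
have e20 : 0 < e / 2 by rewrite divr_gt0.
move/cvgrPdist_lt : cr => /(_ _ e20); move/cvgrPdist_lt : ci => /(_ _ e20).
apply: filterS2 => y hi hr; rewrite normr_complex ltcR.
by rewrite (le_lt_trans (le_normc_ReIm _))// [ltRHS]splitr ltrD// !componentE.
Qed.

Lemma ccont_comp (T : topologicalType) (f : T -> C) (g : C^o -> C^o) x :
  ccont f x -> {for f x, continuous g} -> ccont (fun y => g (f y)) x.
Proof.
move=> /ccontP cf cg; apply/(ccontP (fun y => g (f y))).
by move=> A /cg /cf.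
Qed.

Lemma ccont_cst (T : topologicalType) (c : C) (x : T) : ccont (fun=> c) x.
Proof. by split; exact: cst_continuous. Qed.

Lemma ccontD (T : topologicalType) (f g : T -> C) x :
  ccont f x -> ccont g x -> ccont (fun y => f y + g y) x.
Proof.
move=> [fr fi] [gr gi]; split.
  rewrite (_ : (fun y => _) = (fun y => Re (f y) + Re (g y))).
    exact: continuousD.
  by apply/funext => y; rewrite Re_add.
rewrite (_ : (fun y => _) = (fun y => Im (f y) + Im (g y))).
  exact: continuousD.
by apply/funext => y; rewrite Im_add.
Qed.

Lemma ccontM (T : topologicalType) (f g : T -> C) x :
  ccont f x -> ccont g x -> ccont (fun y => f y * g y) x.
Proof.
move=> [fr fi] [gr gi]; split.
  rewrite (_ : (fun y => _) = (fun y => Re (f y) * Re (g y) - Im (f y) * Im (g y))).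
    by apply: continuousB; exact: continuousM.
  by apply/funext => y; rewrite Re_mul.
rewrite (_ : (fun y => _) = (fun y => Re (f y) * Im (g y) + Im (f y) * Re (g y))).
  by apply: continuousD; exact: continuousM.
by apply/funext => y; rewrite Im_mul.
Qed.

Lemma ccont_sum (T : topologicalType) (I : Type) (s : seq I) (f : I -> T -> C) x :
  (forall i, ccont (f i) x) -> ccont (fun y => \sum_(i <- s) f i y) x.
Proof.
move=> cf; elim: s => [|i s ih].
  rewrite (_ : (fun y => _) = fun=> 0); first exact: ccont_cst.
  by apply/funext => y; rewrite big_nil.
rewrite (_ : (fun y => _) = fun y => f i y + \sum_(i <- s) f i y).
  exact: ccontD.
by apply/funext => y; rewrite big_cons.
Qed.

Lemma ccontJ (T : topologicalType) (f : T -> C) x :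
  ccont f x -> ccont (fun y => (f y)^*) x.
Proof.
move=> [fr fi]; split.
  by rewrite (_ : (fun y => _) = (fun y => Re (f y)))//; apply/funext => y; rewrite Re_conjc.
rewrite (_ : (fun y => _) = (fun y => - Im (f y))); first exact: continuousN.
by apply/funext => y; rewrite Im_conjc.
Qed.

End ComplexContinuity.

Section ComplexDerivative.
Context {R : realType}.
Local Notation C := R[i].

Definition is_cder (f : R -> C) (x : R) (d : C) : Prop :=
  is_derive x 1 (fun y => Re (f y)) (Re d) /\
  is_derive x 1 (fun y => Im (f y)) (Im d).

Lemma cder_val (f : R -> C) x d : is_cder f x d -> cderive f x = d.
Proof.
move=> [hr hi]; rewrite /cderive !derive1E.
by rewrite (@derive_val _ _ _ _ _ _ _ hr) (@derive_val _ _ _ _ _ _ _ hi); case: d hr hi.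
Qed.

Lemma cder_ccont (f : R -> C) x d : is_cder f x d -> ccont f x.
Proof.
by move=> [[/derivable1_diffP dr _] [/derivable1_diffP di _]]; split;
  exact: differentiable_continuous.
Qed.

Lemma cder_near_eq (f g : R -> C) x d :
  (\forall y \near x, f y = g y) -> is_cder f x d -> is_cder g x d.
Proof.
move=> fg [hr hi]; split.
  by apply: near_eq_is_derive hr; apply: filterS fg => y ->.
by apply: near_eq_is_derive hi; apply: filterS fg => y ->.
Qed.

Lemma cder_cst (c : C) x : is_cder (fun=> c) x 0.
Proof. by split; exact: is_derive_cst. Qed.

Lemma cder_real (x : R) : is_cder (fun s => s%:C) x 1.
Proof. by split; [exact: is_derive_id|exact: is_derive_cst]. Qed.

Lemma cderD (f g : R -> C) x df dg :
  is_cder f x df -> is_cder g x dg -> is_cder (fun y => f y + g y) x (df + dg).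
Proof.
move=> [fr fi] [gr gi]; split.
  rewrite (_ : (fun y => _) = (fun y => Re (f y)) + (fun y => Re (g y))).
    by rewrite Re_add; exact: is_deriveD.
  by apply/funext => y; rewrite Re_add.
rewrite (_ : (fun y => _) = (fun y => Im (f y)) + (fun y => Im (g y))).
  by rewrite Im_add; exact: is_deriveD.
by apply/funext => y; rewrite Im_add.
Qed.

Lemma cderM (f g : R -> C) x df dg :
  is_cder f x df -> is_cder g x dg ->
  is_cder (fun y => f y * g y) x (df * g x + f x * dg).
Proof.
move=> [fr fi] [gr gi]; split.
  rewrite (_ : (fun y => _) = (fun y => Re (f y)) * (fun y => Re (g y)) -
                              (fun y => Im (f y)) * (fun y => Im (g y))).
    apply: (is_derive_eq (is_deriveB (is_deriveM fr gr) (is_deriveM fi gi))).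
    by rewrite !componentE /GRing.scale/=; ring.
  by apply/funext => y; rewrite Re_mul.
rewrite (_ : (fun y => _) = (fun y => Re (f y)) * (fun y => Im (g y)) +
                            (fun y => Im (f y)) * (fun y => Re (g y))).
  apply: (is_derive_eq (is_deriveD (is_deriveM fr gi) (is_deriveM fi gr))).
  by rewrite !componentE /GRing.scale/=; ring.
by apply/funext => y; rewrite Im_mul.
Qed.

Lemma cderZ (c : C) (f : R -> C) x df :
  is_cder f x df -> is_cder (fun y => c * f y) x (c * df).
Proof.
by move=> hf; have := cderM (cder_cst c x) hf; rewrite mul0r add0r.
Qed.

Lemma cderZr (c : C) (f : R -> C) x df :
  is_cder f x df -> is_cder (fun y => f y * c) x (df * c).
Proof.
by move=> hf; have := cderM hf (cder_cst c x); rewrite mulr0 addr0.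
Qed.

Lemma cderJ (f : R -> C) x df :
  is_cder f x df -> is_cder (fun y => (f y)^*) x df^*.
Proof.
move=> [fr fi]; split.
  by rewrite Re_conjc (_ : (fun y => _) = (fun y => Re (f y)))//; apply/funext => y; rewrite Re_conjc.
rewrite Im_conjc (_ : (fun y => _) = - (fun y => Im (f y))); first exact: is_deriveN.
by apply/funext => y; rewrite Im_conjc.
Qed.

Lemma cder_sum (I : Type) (s : seq I) (f : I -> R -> C) x (d : I -> C) :
  (forall i, is_cder (f i) x (d i)) ->
  is_cder (fun y => \sum_(i <- s) f i y) x (\sum_(i <- s) d i).
Proof.
move=> hf; elim: s => [|i s ih].
  rewrite big_nil (_ : (fun y => _) = fun=> 0); first exact: cder_cst.
  by apply/funext => y; rewrite big_nil.
rewrite big_cons (_ : (fun y => _) = fun y => f i y + \sum_(i <- s) f i y).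
  exact: cderD.
by apply/funext => y; rewrite big_cons.
Qed.

Lemma cder_horner (p : {poly C}) x :
  is_cder (fun y => p.[y%:C]) x p^`().[x%:C].
Proof.
elim/poly_ind: p => [|p c ih].
  rewrite deriv0 horner0 (_ : (fun y => _) = fun=> 0); first exact: cder_cst.
  by apply/funext => y; rewrite horner0.
rewrite (_ : (fun y => _) = fun y => p.[y%:C] * y%:C + c).
  have := cderD (cderM ih (cder_real x)) (cder_cst c x).
  by congr is_cder; rewrite derivMXaddC !hornerE; ring.
by apply/funext => y; rewrite !hornerE.
Qed.

(** The mechanism of both chain rules below: near [x] the function is an
    increment [u] vanishing at [x], times a factor that is merely continuous. *)
Lemma is_derive_mul_vanish (u g : R -> R) x du :
  u x = 0 -> is_derive x 1 u du -> {for x, continuous g} ->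
  is_derive x 1 (fun y => u y * g y) (du * g x).
Proof.
move=> u0 [du1 du2] cg.
have cv : h^-1 *: (u (h *: 1 + x) * g (h *: 1 + x) - u x * g x) @[h --> 0^'] -->
    (du * g x : R).
  rewrite u0 mul0r (_ : (fun h => _) = fun h : R =>
    (h^-1 *: (u (h *: 1 + x) - u x)) * g (h *: 1 + x)); last first.
    by apply/funext => h; rewrite u0 !subr0 -scalerAl.
  apply: cvgM; first by rewrite -du2; exact: du1.
  have : g (h + x) @[h --> 0^'] --> g x by exact/continuous_withinNshiftx.
  by under [X in _ -> X @ _ --> _]eq_fun do rewrite /GRing.scale/= mulr1.
by apply: DeriveDef; [apply/cvg_ex; exists (du * g x) | exact/cvg_lim].
Qed.

(** The difference quotient [G] of [phi] at [f x], completed by the derivative, is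
    continuous, and the increment of [phi \o f] is that of [f] times [G \o f]. *)
Lemma cder_comp (phi : C^o -> C^o) (f : R -> C) x df :
  derivable phi (f x) 1 -> is_cder f x df ->
  is_cder (fun y => phi (f y)) x (derive1 phi (f x) * df).
Proof.
move=> dphi hf.
pose G (w : C^o) : C^o :=
  if w == f x then derive1 phi (f x) else (phi w - phi (f x)) / (w - f x).
have cG : {for f x, continuous G}.
  apply/continuous_withinNshiftx.
  apply/cvgrPdist_lt => e e0; rewrite /G eqxx derive1E.
  move/cvgrPdist_lt : (dphi) => /(_ e e0) H; near=> h.
  have h0 : h != 0 by near: h; exact: nbhs_dnbhs_neq.
  have : `|'D_1 phi (f x) - h^-1 *: (phi (h *: 1 + f x) - phi (f x))| < e.
    by near: h; exact: H.
  rewrite /= addrK -subr_eq0 addrK (negbTE h0).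
  by rewrite /GRing.scale/= mulr1 mulrC.
have [cGr cGi] := ccont_comp (cder_ccont hf) cG.
have E y : phi (f y) = phi (f x) + (f y - f x) * G (f y).
  rewrite /G; case: eqP => [->|/eqP fyx]; first by rewrite subrr mul0r addr0.
  by rewrite mulrC divfK ?subr_eq0// addrC subrK.
have [dr di] := cderD hf (cder_cst (- f x) x).
rewrite addr0 in dr di.
have er : Re (f x - f x) = 0 by rewrite subrr.
have ei : Im (f x - f x) = 0 by rewrite subrr.
have Gx : G (f x) = derive1 phi (f x) by rewrite /G eqxx.
have h1 := is_derive_mul_vanish er dr cGr.
have h2 := is_derive_mul_vanish ei di cGi.
have h3 := is_derive_mul_vanish er dr cGi.
have h4 := is_derive_mul_vanish ei di cGr.
rewrite Gx in h1 h2 h3 h4.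
split.
  rewrite (_ : (fun y => _) = cst (Re (phi (f x))) +
      ((fun y => Re (f y - f x) * Re (G (f y))) -
       (fun y => Im (f y - f x) * Im (G (f y))))).
    apply: (is_derive_eq (is_deriveD (is_derive_cst _ _ _) (is_deriveB h1 h2))).
    by rewrite !componentE; ring.
  by apply/funext => y; rewrite E Re_add Re_mul.
rewrite (_ : (fun y => _) = cst (Im (phi (f x))) +
    ((fun y => Re (f y - f x) * Im (G (f y))) +
     (fun y => Im (f y - f x) * Re (G (f y))))).
  apply: (is_derive_eq (is_deriveD (is_derive_cst _ _ _) (is_deriveD h3 h4))).
  by rewrite !componentE; ring.
by apply/funext => y; rewrite E Im_add Im_mul.
Unshelve. all: by end_near. Qed.

End ComplexDerivative.

(** * Chain rule for functions with continuous partial derivatives *)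

Section LineDerivative.
Context {R : realType}.

Lemma is_derive_line (V W : normedModType R) (f : V -> W) (a v : V) (s : R) d :
  is_derive s 1 (fun s => f (s *: v + a)) d <-> is_derive (s *: v + a) v f d.
Proof.
have E : (fun h : R => h^-1 *: ((f \o shift (s *: v + a)) (h *: v) - f (s *: v + a)))
  = (fun h => h^-1 *: (((fun s => f (s *: v + a)) \o shift s) (h *: 1) - f (s *: v + a))).
  apply/funext => h /=; congr (_ *: (f _ - _)).
  by rewrite addrA -scalerDl /GRing.scale/= mulr1.
by split=> -[]; rewrite /derivable /derive => h1 h2;
  apply: DeriveDef; rewrite /derivable /derive ?E// -?E.
Qed.

Lemma MVT_sym (g dg : R -> R) (d : R) :
  (forall t : R, `|t| <= `|d| -> is_derive t 1 g (dg t)) ->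
  exists2 t, `|t| <= `|d| & g d - g 0 = d * dg t.
Proof.
move=> dgE.
have cg (t : R) : `|t| <= `|d| -> {for t, continuous g}.
  by move=> /dgE[/derivable1_diffP h _]; exact: differentiable_continuous.
have [d0|d0] := leP 0 d.
  have [||t] := @MVT_segment R g dg 0 d d0.
  - move=> x; rewrite in_itv/= => /andP[x0 xd]; apply: dgE.
    by rewrite !ger0_norm// ltW.
  - apply: continuous_in_subspaceT => x; rewrite inE/= in_itv/= => /andP[x0 xd].
    by apply: cg; rewrite !ger0_norm.
  rewrite in_itv/= => /andP[x0 xd] ->; exists t; first by rewrite !ger0_norm.
  by rewrite subr0 mulrC.
have [||t] := @MVT_segment R g dg d 0 (ltW d0).
- move=> x; rewrite in_itv/= => /andP[x0 xd]; apply: dgE.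
  by rewrite !ler0_norm ?lerN2// ltW.
- apply: continuous_in_subspaceT => x; rewrite inE/= in_itv/= => /andP[x0 xd].
  by apply: cg; rewrite !ler0_norm ?lerN2// ltW.
rewrite in_itv/= => /andP[x0 xd] e; exists t; first by rewrite !ler0_norm ?lerN2// ltW.
by rewrite -opprB e sub0r mulrN opprK mulrC.
Qed.

End LineDerivative.

Section PartialDerivatives.
Context {R : realType}.
Context {n : nat}.
Implicit Types (f : 'rV[R]_n -> R) (a b c : 'rV[R]_n).
Local Notation e_ i := (delta_mx 0 i : 'rV[R]_n).

(** Moving from [a] to [b] one coordinate at a time, with the mean value theorem
    on each of the steps. *)
Lemma coordinate_increments f a b :
  (forall c, (forall i, `|c 0 i - a 0 i| <= `|b 0 i - a 0 i|) ->
     forall i, derivable f c (e_ i)) ->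
  exists xi : 'I_n -> 'rV[R]_n,
    (forall k i, `|xi k 0 i - a 0 i| <= `|b 0 i - a 0 i|) /\
    f b - f a = \sum_k (b 0 k - a 0 k) * 'D_(e_ k) f (xi k).
Proof.
move=> df.
pose stair (k : nat) : 'rV[R]_n := \row_i (if (i < k)%N then b 0 i else a 0 i).
have stairS (k : 'I_n) : stair k.+1 = (b 0 k - a 0 k) *: e_ k + stair k.
  apply/rowP => i; rewrite !mxE eqxx/= ltnS; case: ltngtP => ik.
  - rewrite -val_eqE/= (ltn_eqF ik) mulr0 add0r//.
  - by rewrite -val_eqE/= (gtn_eqF ik) mulr0 add0r.
  - by rewrite (val_inj ik) eqxx mulr1 subrK.
have step (k : 'I_n) : {c : 'rV[R]_n | (forall i, `|c 0 i - a 0 i| <= `|b 0 i - a 0 i|) /\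
    f (stair k.+1) - f (stair k) = (b 0 k - a 0 k) * 'D_(e_ k) f c}.
  apply: cid.
  have box (t : R) : `|t| <= `|b 0 k - a 0 k| ->
      forall i, `|(t *: e_ k + stair k) 0 i - a 0 i| <= `|b 0 i - a 0 i|.
    move=> tk i; rewrite !mxE eqxx/=; case: ltngtP => ik.
    - by rewrite -val_eqE/= (ltn_eqF ik) mulr0 add0r.
    - by rewrite -val_eqE/= (gtn_eqF ik) mulr0 add0r subrr normr0.
    - by rewrite (val_inj ik) eqxx mulr1 addrK.
  have [t /box tb E] := @MVT_sym R (fun t => f (t *: e_ k + stair k))
    (fun t => 'D_(e_ k) f (t *: e_ k + stair k)) (b 0 k - a 0 k)
    (fun t tb => (is_derive_line f _ _ t _).2
       (derivableP (df _ (box t tb) k))).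
  exists (t *: e_ k + stair k); split => //.
  by rewrite -E scale0r add0r stairS.
exists (fun k => sval (step k)); split=> [k i|].
  by have [h _] := svalP (step k); exact: h.
under eq_bigr => k _ do rewrite -(svalP (step k)).2.
rewrite -(big_mkord predT (fun k => f (stair k.+1) - f (stair k))) telescope_sumr//.
by congr (f _ - f _); apply/rowP => i; rewrite !mxE ?ltn_ord.
Qed.

Lemma rV_norm_coord (v : 'rV[R]_n) i : `|v 0 i| <= `|v|.
Proof. by rewrite [leRHS]/Num.Def.normr/= mx_normrE; exact: (le_bigmax _ _ (0, i)). Qed.

Lemma rV_norm_le (v : 'rV[R]_n) (e : R) :
  0 <= e -> (forall i, `|v 0 i| <= e) -> `|v| <= e.
Proof.
move=> e0 h; rewrite /Num.Def.normr/= mx_normrE.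
by apply/bigmax_leP; split=> // -[i j] _; rewrite ord1.
Qed.

(** The coefficients are the partial derivatives at the mean-value points of
    [coordinate_increments], which tend to [a] with the end point. *)
Lemma continuous_partials_increment f a :
  (\forall b \near a, forall i, derivable f b (e_ i)) ->
  (forall i, {for a, continuous (fun b => 'D_(e_ i) f b)}) ->
  exists g : 'I_n -> 'rV[R]_n -> R,
    (forall k, g k a = 'D_(e_ k) f a /\ {for a, continuous (g k)}) /\
    \forall b \near a, f b = f a + \sum_k (b 0 k - a 0 k) * g k b.
Proof.
move=> df cd.
(* The points are chosen for all [b] at once; far from [a], where [f] may fail to
   be derivable, only their distance to [a] is controlled. *)
pose good b (xi : 'I_n -> 'rV[R]_n) :=
  (forall k i, `|xi k 0 i - a 0 i| <= `|b 0 i - a 0 i|) /\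
  ((forall c, (forall i, `|c 0 i - a 0 i| <= `|b 0 i - a 0 i|) ->
     forall i, derivable f c (e_ i)) ->
   f b - f a = \sum_k (b 0 k - a 0 k) * 'D_(e_ k) f (xi k)).
have /choice[xi xiP] b : exists x, good b x.
  have [h|h] := pselect (forall c, (forall i, `|c 0 i - a 0 i| <= `|b 0 i - a 0 i|) ->
     forall i, derivable f c (e_ i)).
    by have [x [h1 h2]] := coordinate_increments h; exists x; split.
  by exists (fun=> a); split=> [k i|/h[]]; rewrite subrr normr0 normr_ge0.
have xi_le b k : `|xi b k - a| <= `|b - a|.
  apply: rV_norm_le => // i; rewrite !mxE.
  by rewrite (le_trans ((xiP b).1 k i))//; have := rV_norm_coord (b - a) i; rewrite !mxE.
have xia k : xi a k = a.
  by apply/eqP; rewrite -subr_eq0 -normr_le0 (le_trans (xi_le a k))// subrr normr0.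
exists (fun k b => 'D_(e_ k) f (xi b k)); split.
  move=> k; split; first by rewrite xia.
  rewrite /prop_for /continuous_at xia; apply/(@cvgrPdist_lt _ _ _ _ (nbhs_filter a)) => e e0.
  have /(@cvgrPdist_lt _ _ _ _ (nbhs_filter a))/(_ e e0)/nbhs_ballP[r /= r0 rP] := cd k.
  apply/nbhs_ballP; exists r => // b; rewrite -ball_normE/= distrC => ab.
  by apply: rP; rewrite -ball_normE/= distrC (le_lt_trans (xi_le b k)).
have /nbhs_ballP[r /= r0 rP] := df.
apply/nbhs_ballP; exists r => // b; rewrite -ball_normE/= distrC => ab.
rewrite -(xiP b).2; first by rewrite subrKC.
move=> c cb; apply: rP; rewrite -ball_normE/= distrC.
apply: le_lt_trans ab; apply: rV_norm_le => // i; rewrite !mxE (le_trans (cb i))//.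
by have := rV_norm_coord (b - a) i; rewrite !mxE.
Qed.

Lemma curve_continuous (ga : R -> 'rV[R]_n) (s : R) (dga : 'I_n -> R) :
  (forall i, is_derive s 1 (fun t => ga t 0 i) (dga i)) -> {for s, continuous ga}.
Proof.
move=> dg; apply: differentiable_continuous; apply/derivable1_diffP.
by apply/derivable_mxP => i j; rewrite ord1; have [] := dg j.
Qed.

(** Along the curve every summand of the increment of [f] is a difference of
    coordinates vanishing at [s], times a continuous factor. *)
Lemma is_derive_curve f (ga : R -> 'rV[R]_n) (s : R) (dga : 'I_n -> R) :
  (\forall b \near ga s, forall i, derivable f b (e_ i)) ->
  (forall i, {for ga s, continuous (fun b => 'D_(e_ i) f b)}) ->
  (forall i, is_derive s 1 (fun t => ga t 0 i) (dga i)) ->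
  is_derive s 1 (fun t => f (ga t)) (\sum_i dga i * 'D_(e_ i) f (ga s)).
Proof.
move=> df cd dg; have cg := curve_continuous dg.
have [g [gP fE]] := continuous_partials_increment df cd.
have dk i : is_derive s 1 (fun t => (ga t 0 i - ga s 0 i) * g i (ga t))
    (dga i * 'D_(e_ i) f (ga s)).
  have [<- cgi] := gP i.
  apply: (@is_derive_mul_vanish _ (fun t => ga t 0 i - ga s 0 i)
    (fun t => g i (ga t))); first by rewrite subrr.
    rewrite -[dga i]subr0.
    exact: (is_deriveB (dg i) (is_derive_cst (ga s 0 i) _ _)).
  by move=> A /cgi /cg.
apply: (near_eq_is_derive (f := fun t => f (ga s) +
    \sum_k (ga t 0 k - ga s 0 k) * g k (ga t))).
  by near=> t; apply/esym; near: t; exact: (cg _ fE).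
rewrite -[X in is_derive _ _ _ X]add0r.
rewrite (_ : (fun t => _) = cst (f (ga s)) +
    \sum_k (fun t => (ga t 0 k - ga s 0 k) * g k (ga t))).
  exact: is_deriveD.
by apply/funext => t; rewrite !fctE /=; congr (_ + _); rewrite fct_sumE.
Unshelve. all: by end_near. Qed.

End PartialDerivatives.

(** * Real integrals over the line *)

Section RealIntegrals.
Context {R : realType}.
Local Notation mu := (@lebesgue_measure R).
Implicit Types f g : R -> R.

Lemma integrable_dominated f g :
  measurable_fun setT f -> mu.-integrable setT (EFin \o g) ->
  (forall x, `|f x| <= g x) -> mu.-integrable setT (EFin \o f).
Proof.
move=> mf ig fg; apply: (le_integrable measurableT _ _ ig).
  exact/measurable_EFinP.
by move=> x _ /=; rewrite lee_fin (le_trans (fg x))// ler_norm.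
Qed.

(** Fundamental theorem of calculus on the whole line, for a primitive that
    vanishes at infinity: the integrals over symmetric segments are
    increments of the primitive. *)
Lemma Rintegral_derive_vanishing (B b : R -> R) :
  (forall x : R, is_derive x 1 B (b x)) -> continuous b ->
  mu.-integrable setT (EFin \o b) ->
  B x @[x --> +oo] --> (0 : R) -> B x @[x --> -oo] --> (0 : R) ->
  \int[mu]_(x in setT) b x = 0.
Proof.
move=> dB cb ib Bp Bn.
pose f_ (n : nat) := (EFin \o b) \_ `[- n.+1%:R, n.+1%:R].
have f_E n : (\int[mu]_(x in setT) f_ n x = (B n.+1%:R - B (- n.+1%:R))%:E)%E.
  rewrite -integral_mkcond.
  have n0 : - n.+1%:R < n.+1%:R :> R.
    by rewrite (@lt_trans _ _ 0)// ?oppr_lt0 ltr0n.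
  have cB (x : R) : {for x, continuous B}.
    by have [/derivable1_diffP h _] := dB x; exact: differentiable_continuous.
  rewrite (continuous_FTC2 n0 (F := B)) ?EFinB//.
  - exact: continuous_subspaceT.
  - split; first by move=> x _; have [] := dB x.
      by apply: cvg_at_right_filter; exact: cB.
    by apply: cvg_at_left_filter; exact: cB.
  - by move=> x _; rewrite derive1E (@derive_val _ _ _ _ _ _ _ (dB x)).
have mb : measurable_fun setT (EFin \o b) := measurable_int mu ib.
have [|||_ _ ] := @dominated_convergence _ _ R mu setT measurableT f_
    (EFin \o b) (abse \o (EFin \o b)) _ mb _ (integrable_abse ib).
- move=> n; apply/(measurable_restrictT _ _).1 => //.
  exact: measurable_funTS.
- apply: aeW => x _; apply: cvg_near_cst.
  have := nbhs_infty_ge (Num.truncn `|x|); apply: filterS => n xn.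
  rewrite /f_ patchE ifT// inE/= in_itv/= -ler_norml.
  by rewrite (le_trans (ltW (Num.Theory.truncnS_gt _)))// ler_nat ltnS.
- apply: aeW => x n _; rewrite /f_ patchE; case: ifP => //= _.
  by rewrite normr0 lee_fin normr_ge0.
move=> cv; rewrite /Rintegral.
suff -> : (\int[mu]_(x in setT) (EFin \o b) x = 0)%E by [].
apply: (cvg_unique _ cv) => //.
rewrite (_ : [sequence _]_n = (fun n => (B n.+1%:R - B (- n.+1%:R))%:E)); last first.
  by apply/funext => n /=; rewrite f_E.
apply: cvg_EFin; first exact: nearW.
rewrite -[X in _ --> X]subr0; apply: cvgB.
  apply: (cvg_comp _ _ _ Bp); apply/cvgryPge => A.
  have := nbhs_infty_ge (Num.truncn `|A|); apply: filterS => n xn.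
  by rewrite (le_trans (ler_norm _))// (le_trans (ltW (Num.Theory.truncnS_gt _)))// ler_nat ltnS.
apply: (cvg_comp _ _ _ Bn); apply/cvgrNyPle => A.
have := nbhs_infty_ge (Num.truncn `|A|); apply: filterS => n xn.
rewrite lerNl (le_trans (ler_norm _))// normrN.
by rewrite (le_trans (ltW (Num.Theory.truncnS_gt _)))// ler_nat ltnS.
Qed.

Lemma is_derive_Rintegral (f df : R -> R -> R) (s0 : R) (G : R -> R) :
  mu.-integrable setT (EFin \o G) ->
  (\forall s \near s0, [/\ mu.-integrable setT (EFin \o f s),
     forall x : R, is_derive s 1 (f^~ x) (df s x) & forall x, `|df s x| <= G x]) ->
  is_derive s0 1 (fun s => \int[mu]_(x in setT) f s x)
    (\int[mu]_(x in setT) df s0 x).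
Proof.
move=> iG /nbhs_ballP[r /= r0 hr].
have I0 : `]s0 - r, s0 + r[%classic s0.
  by rewrite /= in_itv/= ltrBlDr !ltrDl r0.
have hI s : `]s0 - r, s0 + r[%classic s -> ball s0 r s.
  by rewrite /= in_itv/= /ball/= ltr_distlC.
have dfE s x : `]s0 - r, s0 + r[%classic s -> partial1of2 f s x = df s x.
  by move=> /hI/hr[_ /(_ x) [_ h] _]; rewrite partial1of2E.
have intf s : `]s0 - r, s0 + r[%classic s -> mu.-integrable setT (EFin \o f s).
  by move=> /hI/hr[].
have derf s x : `]s0 - r, s0 + r[%classic s -> setT x -> derivable (f^~ x) s 1.
  by move=> /hI/hr[_ /(_ x) [h _] _].
have G0 x : 0 <= G x.
  by have [_ _ h] := hr _ (hI _ I0); exact: le_trans (normr_ge0 _) (h x).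
have ub s x : `]s0 - r, s0 + r[%classic s -> setT x -> `|partial1of2 f s x| <= G x.
  by move=> Is _; rewrite dfE//; have [_ _ h] := hr _ (hI _ Is); exact: h.
apply: DeriveDef; first exact: (derivable_under_integral measurableT I0 intf derf G0 iG ub).
rewrite -derive1E (differentiation_under_integral measurableT I0 intf derf G0 iG ub).
by apply: eq_Rintegral => x _; rewrite -dfE.
Qed.

(** Dominated convergence is a statement on sequences: it is applied to one that
    would contradict continuity. *)
Lemma continuous_Rintegral n (f : 'rV[R]_n -> R -> R) a (G : R -> R) :
  mu.-integrable setT (EFin \o G) ->
  (\forall b \near a, measurable_fun setT (f b) /\ forall x, `|f b x| <= G x) ->
  (forall x, {for a, continuous (f^~ x)}) ->
  {for a, continuous (fun b => \int[mu]_(x in setT) f b x)}.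
Proof.
move=> iG /nbhs_ballP[r /= r0 hr] cf.
rewrite /prop_for /continuous_at; apply/(@cvgrPdist_lt _ _ _ _ (nbhs_filter a)) => e e0.
apply: contrapT => H.
(* A sequence tending to [a] along which the integral stays away from its value. *)
have /choice[u uP] (k : nat) : exists b, ball a (Num.min r k.+1%:R^-1) b /\
    e <= `|\int[mu]_(x in setT) f a x - \int[mu]_(x in setT) f b x|.
  apply: contrapT => H2; apply: H; apply/nbhs_ballP.
  exists (Num.min r k.+1%:R^-1); first by rewrite /= lt_min r0 invr_gt0 ltr0n.
  by move=> b ab; rewrite ltNge; apply/negP => h; apply: H2; exists b.
have ua : u k @[k --> \oo] --> a.
  apply/cvgrPdist_lt => d d0.
  have := near_infty_natSinv_lt (PosNum d0); apply: filterS => k /= kd.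
  have [] := uP k; rewrite -ball_normE/= => h _; apply: lt_trans kd.
  by move: h; rewrite lt_min => /andP[].
have hu k : measurable_fun setT (f (u k)) /\ forall x, `|f (u k) x| <= G x.
  by apply: hr; have [h _] := uP k; apply: le_ball h; rewrite ge_min lexx.
have [ma fa] := hr a (ballxx _ r0).
have [||||_ _ cv] := @dominated_convergence _ _ R mu setT measurableT
    (fun k => EFin \o f (u k)) (EFin \o f a) (EFin \o G) _ _ _ iG.
- by move=> k; apply/measurable_EFinP; have [] := hu k.
- exact/measurable_EFinP.
- apply: aeW => x _ /=; apply: cvg_EFin; first exact: nearW.
  by have := @cvg_comp _ _ _ u (f^~ x) _ _ _ ua (cf x).
- by apply: aeW => x k _ /=; rewrite lee_fin; have [_] := hu k; apply.
have ia : mu.-integrable setT (EFin \o f a) by exact: integrable_dominated iG fa.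
have cv' : \int[mu]_(x in setT) f (u k) x @[k --> \oo] --> \int[mu]_(x in setT) f a x.
  by apply: fine_cvg; rewrite fineK//; exact: integrable_fin_num.
have /cvgrPdist_lt/(_ e e0)[N _ /(_ N (leqnn N))] := cv'.
by rewrite /= ltNge; have [_ ->] := uP N.
Qed.

End RealIntegrals.

(** * Complex integrals over the line *)

Section ComplexIntegrals.
Context {R : realType}.
Local Notation C := R[i].
Local Notation mu := (@lebesgue_measure R).
Implicit Types f g : R -> C.

Definition cmeasurable f : Prop :=
  measurable_fun setT (fun x => Re (f x)) /\
  measurable_fun setT (fun x => Im (f x)).

Definition cintegrable f : Prop :=
  mu.-integrable setT (EFin \o (fun x => Re (f x))) /\
  mu.-integrable setT (EFin \o (fun x => Im (f x))).

Lemma ccont_measurable f : (forall x, ccont f x) -> cmeasurable f.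
Proof.
by move=> cf; split; apply: continuous_measurable_fun => x; have [] := cf x.
Qed.

Lemma cmeasurableD f g :
  cmeasurable f -> cmeasurable g -> cmeasurable (fun x => f x + g x).
Proof.
move=> [fr fi] [gr gi]; split.
  by under eq_fun do rewrite Re_add; exact: measurable_funD.
by under eq_fun do rewrite Im_add; exact: measurable_funD.
Qed.

Lemma cmeasurableM f g :
  cmeasurable f -> cmeasurable g -> cmeasurable (fun x => f x * g x).
Proof.
move=> [fr fi] [gr gi]; split.
  by under eq_fun do rewrite Re_mul; apply: measurable_funB; exact: measurable_funM.
by under eq_fun do rewrite Im_mul; apply: measurable_funD; exact: measurable_funM.
Qed.

Lemma cmeasurableJ f : cmeasurable f -> cmeasurable (fun x => (f x)^*).
Proof.
move=> [fr fi]; split; first by under eq_fun do rewrite Re_conjc.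
under eq_fun do rewrite Im_conjc.
exact: (measurableT_comp (@oppr_measurable _ _)).
Qed.

Lemma cintegrable_dominated f (G : R -> R) :
  cmeasurable f -> mu.-integrable setT (EFin \o G) ->
  (forall x, normc (f x) <= G x) -> cintegrable f.
Proof.
move=> [mr mi] iG fG; split; apply: (integrable_dominated _ iG) => // x;
  by rewrite (le_trans _ (fG x))// ?le_Re_normc ?le_Im_normc.
Qed.

Lemma cintegrableD f g :
  cintegrable f -> cintegrable g -> cintegrable (fun x => f x + g x).
Proof.
move=> [fr fi] [gr gi]; split.
  rewrite (_ : EFin \o _ = (EFin \o (fun x => Re (f x))) \+ (EFin \o (fun x => Re (g x))))%E.
    exact: integrableD.
  by apply/funext => x /=; rewrite Re_add EFinD.
rewrite (_ : EFin \o _ = (EFin \o (fun x => Im (f x))) \+ (EFin \o (fun x => Im (g x))))%E.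
  exact: integrableD.
by apply/funext => x /=; rewrite Im_add EFinD.
Qed.

Lemma integrableZ_real (a : R) (u : R -> R) : mu.-integrable setT (EFin \o u) ->
  mu.-integrable setT (EFin \o (fun x => a * u x)).
Proof.
move=> iu; rewrite (_ : EFin \o _ = (fun x => a%:E * (EFin \o u) x)%E).
  exact: integrableZl.
by apply/funext => x /=; rewrite EFinM.
Qed.

Lemma integrableD_real (u v : R -> R) : mu.-integrable setT (EFin \o u) ->
  mu.-integrable setT (EFin \o v) -> mu.-integrable setT (EFin \o (fun x => u x + v x)).
Proof.
move=> iu iv; rewrite (_ : EFin \o _ = (EFin \o u) \+ (EFin \o v))%E.
  exact: integrableD.
by apply/funext => x /=; rewrite EFinD.
Qed.

Lemma cintegrableZ (c : C) f : cintegrable f -> cintegrable (fun x => c * f x).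
Proof.
move=> [fr fi]; split.
  rewrite (_ : (fun x => _) = fun x => Re c * Re (f x) + (- Im c) * Im (f x)).
    by apply: integrableD_real; exact: integrableZ_real.
  by apply/funext => x; rewrite Re_mul mulNr.
rewrite (_ : (fun x => _) = fun x => Re c * Im (f x) + Im c * Re (f x)).
  by apply: integrableD_real; exact: integrableZ_real.
by apply/funext => x; rewrite Im_mul.
Qed.

Lemma cintegralD f g : cintegrable f -> cintegrable g ->
  cintegral (fun x => f x + g x) = cintegral f + cintegral g.
Proof.
move=> [fr fi] [gr gi]; apply: complex_eq; rewrite ?Re_add ?Im_add /=.
  by under eq_Rintegral do rewrite Re_add; exact: RintegralD.
by under eq_Rintegral do rewrite Im_add; exact: RintegralD.
Qed.

Lemma cintegralZ (c : C) f : cintegrable f ->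
  cintegral (fun x => c * f x) = c * cintegral f.
Proof.
move=> [fr fi]; apply: complex_eq; rewrite ?Re_mul ?Im_mul /=.
  under eq_Rintegral do rewrite Re_mul -mulNr.
  by rewrite RintegralD ?RintegralZl ?mulNr//; exact: integrableZ_real.
under eq_Rintegral do rewrite Im_mul.
by rewrite RintegralD ?RintegralZl//; exact: integrableZ_real.
Qed.

Lemma cintegralJ f : cintegrable f ->
  cintegral (fun x => (f x)^*) = (cintegral f)^*.
Proof.
move=> [fr fi]; apply: complex_eq; rewrite ?Re_conjc ?Im_conjc /=.
  by under eq_Rintegral do rewrite Re_conjc.
by under eq_Rintegral do rewrite Im_conjc -mulN1r; rewrite RintegralZl// mulN1r.
Qed.

Lemma cintegral_sum (I : Type) (s : seq I) (f : I -> R -> C) :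
  (forall i, cintegrable (f i)) ->
  cintegrable (fun x => \sum_(i <- s) f i x) /\
  cintegral (fun x => \sum_(i <- s) f i x) = \sum_(i <- s) cintegral (f i).
Proof.
move=> hf; elim: s => [|i s [ih1 ih2]].
  rewrite big_nil (_ : (fun x => _) = fun=> 0); last first.
    by apply/funext => x; rewrite big_nil.
  split; first by split; exact: integrable0.
  by apply: complex_eq; rewrite /= Rintegral_cst// mul0r.
rewrite big_cons (_ : (fun x => _) = fun x => f i x + \sum_(i <- s) f i x); last first.
  by apply/funext => x; rewrite big_cons.
by split; [exact: cintegrableD|rewrite cintegralD// ih2].
Qed.

Lemma cder_cintegral (f df : R -> R -> C) (s0 : R) (G : R -> R) :
  mu.-integrable setT (EFin \o G) ->
  (\forall s \near s0, [/\ cintegrable (f s),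
     forall x, is_cder (f^~ x) s (df s x) & forall x, normc (df s x) <= G x]) ->
  is_cder (fun s => cintegral (f s)) s0 (cintegral (df s0)).
Proof.
move=> iG hf; split.
  apply: (@is_derive_Rintegral _ (fun s x => Re (f s x)) (fun s x => Re (df s x)) s0 G iG).
  apply: filterS hf => s [[ir ii] d b]; split=> // x; first by have [] := d x.
  exact: le_trans (le_Re_normc _) (b x).
apply: (@is_derive_Rintegral _ (fun s x => Im (f s x)) (fun s x => Im (df s x)) s0 G iG).
apply: filterS hf => s [[ir ii] d b]; split=> // x; first by have [] := d x.
exact: le_trans (le_Im_normc _) (b x).
Qed.

Lemma ccont_cintegral n (f : 'rV[R]_n -> R -> C) a (G : R -> R) :
  mu.-integrable setT (EFin \o G) ->
  (\forall b \near a, cmeasurable (f b) /\ forall x, normc (f b x) <= G x) ->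
  (forall x, ccont (f^~ x) a) -> ccont (fun b => cintegral (f b)) a.
Proof.
move=> iG hf cf; split.
  apply: (continuous_Rintegral iG) => [|x]; last by have [] := cf x.
  apply: filterS hf => b [[mr mi] h]; split=> // x.
  exact: le_trans (le_Re_normc _) (h x).
apply: (continuous_Rintegral iG) => [|x]; last by have [] := cf x.
apply: filterS hf => b [[mr mi] h]; split=> // x.
exact: le_trans (le_Im_normc _) (h x).
Qed.

Lemma normc_cvg0 (F : set_system R) {FF : Filter F} f :
  normc (f x) @[x --> F] --> (0 : R) ->
  Re (f x) @[x --> F] --> (0 : R) /\ Im (f x) @[x --> F] --> (0 : R).
Proof.
move=> /cvgr0Pnorm_lt h; split; apply/cvgr0Pnorm_lt => e /h;
  apply: filterS => x; apply: le_lt_trans; rewrite (ger0_norm (normc_ge0 _)).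
  exact: le_Re_normc.
exact: le_Im_normc.
Qed.

Lemma cintegral_derive_vanishing (B b : R -> C) :
  (forall x, is_cder B x (b x)) -> (forall x, ccont b x) -> cintegrable b ->
  normc (B x) @[x --> +oo] --> (0 : R) -> normc (B x) @[x --> -oo] --> (0 : R) ->
  cintegral b = 0.
Proof.
move=> dB cb [ir ii] /normc_cvg0[pr pi] /normc_cvg0[nr ni].
apply: complex_eq => /=.
  apply: (@Rintegral_derive_vanishing _ (fun x => Re (B x))) => // x.
    by have [] := dB x.
  by have [] := cb x.
apply: (@Rintegral_derive_vanishing _ (fun x => Im (B x))) => // x.
  by have [] := dB x.
by have [] := cb x.
Qed.

End ComplexIntegrals.

(** * Square-integrable functions *)

Section SquareIntegrable.
Context {R : realType}.
Local Notation C := R[i].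
Local Notation mu := (@lebesgue_measure R).
Implicit Types f g k : R -> C.

Lemma in_H_measurable f : in_H f -> cmeasurable f.
Proof. by case. Qed.

Lemma in_H_dominated f (G : R -> R) :
  cmeasurable f -> mu.-integrable setT (EFin \o G) ->
  (forall x, normc (f x) ^+ 2 <= G x) -> in_H f.
Proof.
move=> [mr mi] iG fG; split=> //.
apply: (@integrable_dominated _ (fun x => normc (f x) ^+ 2) G) => //.
  under eq_fun do rewrite normc_sqr.
  by apply: measurable_funD; exact: measurable_funX.
by move=> x; rewrite ger0_norm ?sqr_ge0.
Qed.

Lemma normcM_le (x y : C) : normc (x * y) <= normc x ^+ 2 + normc y ^+ 2.
Proof.
rewrite ComplexField.Normc.normcM; have := sqr_ge0 (normc x - normc y).
have := normc_ge0 x; have := normc_ge0 y; nra.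
Qed.

Lemma normcJ_eq (x : C) : normc x^* = normc x.
Proof. by case: x => a b /=; rewrite sqrrN. Qed.

(** Domination by [|f|^2 + |g|^2]. *)
Lemma in_H_inner f g : in_H f -> in_H g -> cintegrable (fun x => f x * (g x)^*).
Proof.
move=> Hf Hg; have [_ _ i1] := Hf; have [_ _ i2] := Hg.
apply: (cintegrable_dominated _ (integrableD_real i1 i2)).
  apply: cmeasurableM; first exact: in_H_measurable.
  by apply: cmeasurableJ; exact: in_H_measurable.
by move=> x; rewrite (le_trans (normcM_le _ _))// normcJ_eq.
Qed.

Lemma in_HD f g : in_H f -> in_H g -> in_H (fun x => f x + g x).
Proof.
move=> Hf Hg; have [_ _ i1] := Hf; have [_ _ i2] := Hg.
apply: (in_H_dominated _ (integrableD_real (integrableZ_real 2 i1) (integrableZ_real 2 i2))).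
  by apply: cmeasurableD; exact: in_H_measurable.
move=> x; rewrite !normc_sqr Re_add Im_add.
have := sqr_ge0 (Re (f x) - Re (g x)); have := sqr_ge0 (Im (f x) - Im (g x)); nra.
Qed.

Lemma in_HZ (c : C) f : in_H f -> in_H (fun x => c * f x).
Proof.
move=> Hf; have [_ _ i1] := Hf.
apply: (in_H_dominated _ (integrableZ_real (normc c ^+ 2) i1)).
  by apply: cmeasurableM; [apply: ccont_measurable => x; exact: ccont_cst|exact: in_H_measurable].
by move=> x; rewrite ComplexField.Normc.normcM exprMn.
Qed.

Lemma in_HN f : in_H f -> in_H (fun x => - f x).
Proof. by move=> /(in_HZ (-1)); under [X in in_H X -> _]eq_fun do rewrite mulN1r. Qed.

Lemma in_H_sum (I : Type) (s : seq I) (f : I -> R -> C) :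
  (forall i, in_H (f i)) -> in_H (fun x => \sum_(i <- s) f i x).
Proof.
move=> hf; elim: s => [|i s ih].
  rewrite (_ : (fun x => _) = fun=> 0); last by apply/funext => x; rewrite big_nil.
  apply: (@in_H_dominated _ (fun=> 0)).
  - by apply: ccont_measurable => x; exact: ccont_cst.
  - exact: integrable0.
  - by move=> x; rewrite normc_sqr /= expr0n addr0.
rewrite (_ : (fun x => _) = fun x => f i x + \sum_(i <- s) f i x).
  exact: in_HD.
by apply/funext => x; rewrite big_cons.
Qed.

Lemma inner_conj f g : in_H f -> in_H g -> inner g f = (inner f g)^*.
Proof.
move=> Hf Hg; rewrite /inner -cintegralJ; last exact: in_H_inner.
by congr cintegral; apply/funext => x; rewrite rmorphM/= conjcK mulrC.
Qed.

Lemma innerDl f g k : in_H f -> in_H g -> in_H k ->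
  inner (fun x => f x + g x) k = inner f k + inner g k.
Proof.
move=> Hf Hg Hk; rewrite /inner -cintegralD; [|exact: in_H_inner..].
by congr cintegral; apply/funext => x; rewrite mulrDl.
Qed.

Lemma innerZl (c : C) f g : in_H f -> in_H g ->
  inner (fun x => c * f x) g = c * inner f g.
Proof.
move=> Hf Hg; rewrite /inner -cintegralZ; last exact: in_H_inner.
by congr cintegral; apply/funext => x; rewrite mulrA.
Qed.

Lemma inner_suml (I : Type) (s : seq I) (f : I -> R -> C) g :
  (forall i, in_H (f i)) -> in_H g ->
  inner (fun x => \sum_(i <- s) f i x) g = \sum_(i <- s) inner (f i) g.
Proof.
move=> Hf Hg; have [_ <-] := cintegral_sum s (fun i => in_H_inner (Hf i) Hg).
by congr cintegral; apply/funext => x; rewrite mulr_suml.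
Qed.

Lemma inner_self_ge0 f : 0 <= Re (inner f f).
Proof.
rewrite /=; apply: Rintegral_ge0 => x _.
by rewrite Re_mul Re_conjc Im_conjc mulrN opprK addr_ge0// -expr2 sqr_ge0.
Qed.

End SquareIntegrable.

(** * Functions of two complex variables and Wirtinger derivatives *)

Section CkClosure.
Context {R : realType} {n : nat}.
Implicit Types f g : 'rV[R]_n -> R.

Lemma Ck_lin k (c d : R) f g :
  Ck k f -> Ck k g -> Ck k (fun y => c * f y + d * g y).
Proof.
have lin_cont u v : continuous u -> continuous v ->
    continuous (fun y : 'rV[R]_n => c * u y + d * v y).
  move=> cu cv y.
  exact: (continuousD (continuousM (@cst_continuous _ _ c y) (cu y))
    (continuousM (@cst_continuous _ _ d y) (cv y))).
elim: k f g => [|k ih] f g.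
  by move=> [cf _] [cg _]; split=> //; exact: lin_cont.
move=> [cf hf] [cg hg]; split; first exact: lin_cont.
move=> i; have [df kf] := hf i; have [dg kg] := hg i.
have D y : is_derive y (delta_mx 0 i : 'rV[R]_n) (fun y => c * f y + d * g y)
    (c * 'D_(delta_mx 0 i) f y + d * 'D_(delta_mx 0 i) g y).
  by apply: is_deriveD; apply: is_deriveZ; exact: derivableP.
split; first by move=> y; have [] := D y.
rewrite (_ : (fun y => _) =
  (fun y => c * 'D_(delta_mx 0 i) f y + d * 'D_(delta_mx 0 i) g y)); first exact: ih.
by apply/funext => y; exact: (@derive_val _ _ _ _ _ _ _ (D y)).
Qed.

End CkClosure.

Section TwoComplexVariables.
Context {R : realType}.
Local Notation C := R[i].
Implicit Types (H : C -> C -> C) (u p : C).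

Definition real_form H (y : 'rV[R]_4) : C :=
  H (y 0 (inord 0) +i* y 0 (inord 1)) (y 0 (inord 2) +i* y 0 (inord 3)).

Definition complex_pair u p : 'rV[R]_4 :=
  \row_i nth 0 [:: Re u; Im u; Re p; Im p] i.

Definition real_Ck k H : Prop :=
  Ck k (fun y => Re (real_form H y)) /\ Ck k (fun y => Im (real_form H y)).

Lemma real_formE H u p : real_form H (complex_pair u p) = H u p.
Proof. by rewrite /real_form !mxE !inordK//=; case: u; case: p. Qed.

Lemma complex_pairE (y : 'rV[R]_4) :
  complex_pair (y 0 (inord 0) +i* y 0 (inord 1)) (y 0 (inord 2) +i* y 0 (inord 3)) = y.
Proof.
apply/rowP => -[i i4]; rewrite mxE/=.
by case: i i4 => [|[|[|[|//]]]] i4 /=; congr (y 0 _); apply: val_inj; rewrite /= inordK.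
Qed.

Section Curve.
Variables (a b : R -> C) (s : R) (da db : C).
Hypotheses (ha : is_cder a s da) (hb : is_cder b s db).
Let ga t := complex_pair (a t) (b t).

Let dga (i : 'I_4) : is_derive s 1 (fun t => ga t 0 i) (complex_pair da db 0 i).
Proof.
have [ar ai] := ha; have [br bi] := hb.
under eq_fun do rewrite mxE.
rewrite mxE; case: i => [[|[|[|[|//]]]] i4] //=.
Qed.

Lemma pair_curve_continuous (f : 'rV[R]_4 -> R) : continuous f ->
  {for s, continuous (fun t => f (complex_pair (a t) (b t)))}.
Proof. by move=> cf; have cg := curve_continuous dga; move=> A /cf /cg. Qed.

Lemma is_derive_pair_curve (f : 'rV[R]_4 -> R) : Ck 1 f ->
  is_derive s 1 (fun t => f (complex_pair (a t) (b t)))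
  (Re da * 'D_(delta_mx 0 (inord 0)) f (ga s) +
   Im da * 'D_(delta_mx 0 (inord 1)) f (ga s) +
   Re db * 'D_(delta_mx 0 (inord 2)) f (ga s) +
   Im db * 'D_(delta_mx 0 (inord 3)) f (ga s)).
Proof.
move=> [_ hf].
have := is_derive_curve (f := f) (s := s) _ _ dga.
move=> /(_ (nearW (nbhs_filter _) (fun c i => (hf i).1 c)) (fun i => (hf i).2.1 (ga s))).
congr is_derive.
rewrite (eq_bigr (fun i : 'I_4 => nth 0 [:: Re da; Im da; Re db; Im db] i *
  'D_(delta_mx 0 (inord i)) f (ga s))); last by move=> i _; rewrite inord_val mxE.
rewrite -(big_mkord predT (fun i => nth 0 [:: Re da; Im da; Re db; Im db] i *
  'D_(delta_mx 0 (inord i)) f (ga s))).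
by rewrite !big_nat_recr//= big_nil add0r.
Qed.

End Curve.

Lemma cder_pair_curve H (a b : R -> C) s u p da db : real_Ck 1 H ->
  a s = u -> b s = p -> is_cder a s da -> is_cder b s db ->
  is_cder (fun t => H (a t) (b t)) s
  ((Re da)%:C * cpartial (inord 0) (real_form H) (complex_pair u p) +
   (Im da)%:C * cpartial (inord 1) (real_form H) (complex_pair u p) +
   (Re db)%:C * cpartial (inord 2) (real_form H) (complex_pair u p) +
   (Im db)%:C * cpartial (inord 3) (real_form H) (complex_pair u p)).
Proof.
move=> [hr hi] <- <- ha hb; rewrite complex_lin4; split.
  by have := is_derive_pair_curve ha hb hr; under eq_fun do rewrite real_formE.
by have := is_derive_pair_curve ha hb hi; under eq_fun do rewrite real_formE.
Qed.

Lemma lin4_basis (P Q S T : C) (l := fun d e : C =>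
    (Re d)%:C * P + (Im d)%:C * Q + (Re e)%:C * S + (Im e)%:C * T) :
  [/\ l 1 0 = P, l ('i * 1) 0 = Q, l 0 1 = S & l 0 ('i * 1) = T].
Proof. by rewrite /l mulr1 /= !mul0r !mul1r !addr0 !add0r. Qed.

Lemma cder_translate (u c : C) : is_cder (fun s : R => u + c * s%:C) 0 (c * 1).
Proof. by have := cderD (cder_cst u 0) (cderZ c (cder_real 0)); rewrite add0r. Qed.

Lemma partial_uE H u p : real_Ck 1 H ->
  cderive (fun s => H (u + s%:C) p) 0 =
    cpartial (inord 0) (real_form H) (complex_pair u p) /\
  cderive (fun s => H (u + 'i * s%:C) p) 0 =
    cpartial (inord 1) (real_form H) (complex_pair u p).
Proof.
move=> hH.
have [e1 e2 _ _] := lin4_basis (cpartial (inord 0) (real_form H) (complex_pair u p))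
  (cpartial (inord 1) (real_form H) (complex_pair u p))
  (cpartial (inord 2) (real_form H) (complex_pair u p))
  (cpartial (inord 3) (real_form H) (complex_pair u p)).
split.
  rewrite -e1; apply: cder_val.
  apply: (cder_pair_curve (a := fun s => u + s%:C) (b := fun=> p) hH) => //; first exact: addr0.
    have := cder_translate u 1; rewrite mul1r.
    by under eq_fun do rewrite mul1r.
  exact: cder_cst.
rewrite -e2; apply: cder_val.
  apply: (cder_pair_curve (a := fun s => u + 'i * s%:C) (b := fun=> p) hH) => //.
- by rewrite mulr0 addr0.
- exact: cder_translate.
- exact: cder_cst.
Qed.

Lemma partial_pE H u p : real_Ck 1 H ->
  cderive (fun s => H u (p + s%:C)) 0 =
    cpartial (inord 2) (real_form H) (complex_pair u p) /\
  cderive (fun s => H u (p + 'i * s%:C)) 0 =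
    cpartial (inord 3) (real_form H) (complex_pair u p).
Proof.
move=> hH.
have [_ _ e1 e2] := lin4_basis (cpartial (inord 0) (real_form H) (complex_pair u p))
  (cpartial (inord 1) (real_form H) (complex_pair u p))
  (cpartial (inord 2) (real_form H) (complex_pair u p))
  (cpartial (inord 3) (real_form H) (complex_pair u p)).
split.
  rewrite -e1; apply: cder_val.
  apply: (cder_pair_curve (a := fun=> u) (b := fun s => p + s%:C) hH) => //; first exact: addr0.
    exact: cder_cst.
  have := cder_translate p 1; rewrite mul1r.
  by under eq_fun do rewrite mul1r.
rewrite -e2; apply: cder_val.
  apply: (cder_pair_curve (a := fun=> u) (b := fun s => p + 'i * s%:C) hH) => //.
- by rewrite mulr0 addr0.
- exact: cder_cst.
- exact: cder_translate.
Qed.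

Lemma wirtinger_components (P Q : C) :
  [/\ Re (2^-1 * (P - 'i * Q)) = 2^-1 * Re P + 2^-1 * Im Q,
      Im (2^-1 * (P - 'i * Q)) = 2^-1 * Im P + (- 2^-1) * Re Q,
      Re (2^-1 * (P + 'i * Q)) = 2^-1 * Re P + (- 2^-1) * Im Q &
      Im (2^-1 * (P + 'i * Q)) = 2^-1 * Im P + 2^-1 * Re Q].
Proof. by split; rewrite !componentE /=; field. Qed.

Lemma wirtinger_differential (P Q S T d e : C) :
  (Re d)%:C * P + (Im d)%:C * Q + (Re e)%:C * S + (Im e)%:C * T =
  2^-1 * (P - 'i * Q) * d + 2^-1 * (P + 'i * Q) * d^* +
  (2^-1 * (S - 'i * T) * e + 2^-1 * (S + 'i * T) * e^*).
Proof.
case: P Q S T d e => [P P'] [Q Q'] [S S'] [T T'] [d d'] [e e'].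
by rewrite !half_complex; apply: complex_eq => /=; field.
Qed.

(** An increment [d] and its conjugate, multiplied by the two Wirtinger derivatives,
    add up to the real differential. *)
Lemma cder_wirtinger H (a b : R -> C) s da db : real_Ck 1 H ->
  is_cder a s da -> is_cder b s db ->
  is_cder (fun t => H (a t) (b t)) s
   (h_u H (a s) (b s) * da + h_ubar H (a s) (b s) * da^* +
    (h_p H (a s) (b s) * db + h_pbar H (a s) (b s) * db^*)).
Proof.
move=> hH ha hb; have := cder_pair_curve hH erefl erefl ha hb.
have [u1 u2] := partial_uE (a s) (b s) hH.
have [p1 p2] := partial_pE (a s) (b s) hH.
rewrite /h_u /h_ubar /h_p /h_pbar /wirt /wirt_bar u1 u2 p1 p2.
by rewrite wirtinger_differential.
Qed.

(** Used for the continuity in [x] of the integrands that the fundamental theorem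
    of calculus is applied to. *)
Lemma ccont_wirtinger H (a b : R -> C) s da db : real_Ck 1 H ->
  is_cder a s da -> is_cder b s db ->
  [/\ ccont (fun t => h_u H (a t) (b t)) s, ccont (fun t => h_ubar H (a t) (b t)) s,
      ccont (fun t => h_p H (a t) (b t)) s & ccont (fun t => h_pbar H (a t) (b t)) s].
Proof.
move=> hH ha hb.
have cP k : ccont (fun t => cpartial k (real_form H) (complex_pair (a t) (b t))) s.
  have [[_ hr] [_ hi]] := hH; split.
    exact: (pair_curve_continuous ha hb (hr k).2.1).
  exact: (pair_curve_continuous ha hb (hi k).2.1).
have cu t := partial_uE (a t) (b t) hH.
have cp t := partial_pE (a t) (b t) hH.
split; rewrite /h_u /h_ubar /h_p /h_pbar /wirt /wirt_bar;
  (under eq_fun do rewrite ?(cu _).1 ?(cu _).2 ?(cp _).1 ?(cp _).2 -?mulNr);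
  by apply: ccontM (ccont_cst _ _) (ccontD _ (ccontM (ccont_cst _ _) _)); exact: cP.
Qed.

Lemma real_Ck_le H : real_Ck 2 H -> real_Ck 1 H.
Proof.
by move=> [[cr hr] [ci hi]]; split; split=> // i;
  [have [d [c _]] := hr i|have [d [c _]] := hi i].
Qed.

(** It is this regularity that lets [h_p] and [h_pbar] be differentiated in [x]
    along a wave. *)
Lemma real_Ck_h_p H : real_Ck 2 H -> real_Ck 1 (h_p H) /\ real_Ck 1 (h_pbar H).
Proof.
move=> h2; have h1 := real_Ck_le h2; have [[_ hr] [_ hi]] := h2.
have hpE y : real_form (h_p H) y = 2^-1 * (cpartial (inord 2) (real_form H) y -
    'i * cpartial (inord 3) (real_form H) y).
  rewrite {1}/real_form /h_p /wirt.
  by rewrite (partial_pE _ _ h1).1 (partial_pE _ _ h1).2 complex_pairE.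
have hqE y : real_form (h_pbar H) y = 2^-1 * (cpartial (inord 2) (real_form H) y +
    'i * cpartial (inord 3) (real_form H) y).
  rewrite {1}/real_form /h_pbar /wirt_bar.
  by rewrite (partial_pE _ _ h1).1 (partial_pE _ _ h1).2 complex_pairE.
pose D (k : nat) (f : 'rV[R]_4 -> R) (y : 'rV[R]_4) := 'D_(delta_mx 0 (inord k)) f y.
have r k : Ck 1 (D k (fun y => Re (real_form H y))) := (hr (inord k)).2.
have i k : Ck 1 (D k (fun y => Im (real_form H y))) := (hi (inord k)).2.
split; split.
- have := Ck_lin 2^-1 2^-1 (r 2) (i 3); congr Ck; apply/funext => y.
  by rewrite hpE; have [-> _ _ _] := wirtinger_components
    (cpartial (inord 2) (real_form H) y) (cpartial (inord 3) (real_form H) y).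
- have := Ck_lin 2^-1 (- 2^-1) (i 2) (r 3); congr Ck; apply/funext => y.
  by rewrite hpE; have [_ -> _ _] := wirtinger_components
    (cpartial (inord 2) (real_form H) y) (cpartial (inord 3) (real_form H) y).
- have := Ck_lin 2^-1 (- 2^-1) (r 2) (i 3); congr Ck; apply/funext => y.
  by rewrite hqE; have [_ _ -> _] := wirtinger_components
    (cpartial (inord 2) (real_form H) y) (cpartial (inord 3) (real_form H) y).
- have := Ck_lin 2^-1 2^-1 (i 2) (r 3); congr Ck; apply/funext => y.
  by rewrite hqE; have [_ _ _ ->] := wirtinger_components
    (cpartial (inord 2) (real_form H) y) (cpartial (inord 3) (real_form H) y).
Qed.

End TwoComplexVariables.

(** * Holomorphic waves with polynomial phase *)

Section CoordinateFunctions.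
Context {R : realType}.

Fixpoint C1d (k : nat) (u : R -> R) : Prop :=
  continuous u /\
  if k is k'.+1 then (forall x : R, derivable u x 1) /\ C1d k' (fun x => 'D_1 u x)
  else True.

Lemma Ck_coord n (i : 'I_n) k u : C1d k u -> Ck k (fun y : 'rV[R]_n => u (y 0 i)).
Proof.
elim: k u => [|k ih] u.
  move=> [cu _]; split=> // y.
  by have := @continuous_comp _ _ _ (fun y : 'rV[R]_n => y 0 i) u y
    (@coord_continuous _ _ _ 0 i y) (cu _).
move=> [cu [du ku]]; split.
  move=> y.
  by have := @continuous_comp _ _ _ (fun y : 'rV[R]_n => y 0 i) u y
    (@coord_continuous _ _ _ 0 i y) (cu _).
move=> j.
have D y : is_derive y (delta_mx 0 j : 'rV[R]_n) (fun y : 'rV[R]_n => u (y 0 i))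
    ((i == j)%:R * 'D_1 u (y 0 i)).
  have := (is_derive_line (fun y : 'rV[R]_n => u (y 0 i)) y (delta_mx 0 j) 0
    ((i == j)%:R * 'D_1 u (y 0 i))).1.
  rewrite scale0r add0r; apply.
  under eq_fun do rewrite !mxE eqxx/=.
  have hc : is_derive (0 : R) 1 (fun s : R => s * (i == j)%:R + y 0 i) ((i == j)%:R).
    apply: is_derive_eq; rewrite /GRing.scale/= !mulr1 mulr0 addr0 add0r//.
  have hu : is_derive ((fun s : R => s * (i == j)%:R + y 0 i) 0) 1 u ('D_1 u (y 0 i)).
    by rewrite /= mul0r add0r; exact: derivableP.
  have := @is_derive1_comp _ u (fun s : R => s * (i == j)%:R + y 0 i) 0 _ _ hu hc.
  rewrite /GRing.scale/= mulrC.
  by [].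
split; first by move=> y; have [] := D y.
have : Ck k (fun y : 'rV[R]_n => (i == j)%:R * 'D_1 u (y 0 i) + 0 * 'D_1 u (y 0 i)).
  by apply: Ck_lin; exact: (ih (fun x => 'D_1 u x) ku).
congr Ck; apply/funext => y; rewrite mul0r addr0.
by rewrite (@derive_val _ _ _ _ _ _ _ (D y)).
Qed.

End CoordinateFunctions.

Section HolomorphicAnsatz.
Context {R : realType}.
Local Notation C := R[i].
Variable phi : C -> C.
Hypothesis phi_C2 : complex_C2 phi.
Implicit Types p r : {poly C}.

Let dphi : C^o -> C^o := derive1 (phi : C^o -> C^o).
Let ddphi : C^o -> C^o := derive1 dphi.

Let phi_der z : derivable (phi : C^o -> C^o) z 1.
Proof. by have [] := phi_C2. Qed.

Let dphi_der z : derivable dphi z 1.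
Proof. by have [_] := phi_C2. Qed.

Let ddphi_cont z : {for z, continuous ddphi}.
Proof. by have [_ _] := phi_C2; exact. Qed.

(** As [phi] is holomorphic, one formula covers the derivatives of the wave with
    respect to its phase and to space: [tangent p r] is the derivative in the
    direction [r], and [tangent p p^`()] is the space derivative. *)
Definition wave p (x : R) : C := phi p.[x%:C].
Definition tangent p r (x : R) : C := dphi p.[x%:C] * r.[x%:C].
Definition tangent2 p r r' (x : R) : C := ddphi p.[x%:C] * r.[x%:C] * r'.[x%:C].

Lemma cder_wave (P : R -> C) s dP :
  is_cder P s dP -> is_cder (fun s => phi (P s)) s (dphi (P s) * dP).
Proof. by move=> hP; exact: (cder_comp (@phi_der (P s)) hP). Qed.

Lemma cder_dwave (P : R -> C) s dP :
  is_cder P s dP -> is_cder (fun s => dphi (P s)) s (ddphi (P s) * dP).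
Proof. by move=> hP; exact: (cder_comp (@dphi_der (P s)) hP). Qed.

Lemma cder_wave_x p x : is_cder (wave p) x (tangent p p^`() x).
Proof. by apply: cder_wave; exact: cder_horner. Qed.

Lemma cder_tangent_x p r x :
  is_cder (tangent p r) x (tangent2 p r p^`() x + tangent p r^`() x).
Proof.
have := cderM (cder_dwave (cder_horner p x)) (cder_horner r x).
by congr is_cder; rewrite /tangent2 mulrAC.
Qed.

Let cder_line p r x s : is_cder (fun s => (p + s%:C *: r).[x%:C]) s r.[x%:C].
Proof.
under eq_fun do rewrite hornerD hornerZ.
have := cderD (cder_cst p.[x%:C] s) (cderZr r.[x%:C] (cder_real s)).
by rewrite add0r mul1r.
Qed.

Lemma cder_wave_s p r x s :
  is_cder (fun s => wave (p + s%:C *: r) x) s (tangent (p + s%:C *: r) r x).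
Proof. by apply: cder_wave; exact: cder_line. Qed.

Lemma cder_tangent_s p r r' x s :
  is_cder (fun s => tangent (p + s%:C *: r) r' x) s (tangent2 (p + s%:C *: r) r' r x).
Proof.
have := cderZr r'.[x%:C] (cder_dwave (cder_line p r x s)).
by congr is_cder; exact: mulrAC.
Qed.

(** Differentiation in the parameter and in space commute: the value is also the
    space derivative of [tangent ps r], by [cder_tangent_x]. *)
Lemma cder_wave_xs p r x s (ps := p + s%:C *: r) :
  is_cder (fun s => tangent (p + s%:C *: r) (p + s%:C *: r)^`() x) s
    (tangent2 ps r ps^`() x + tangent ps r^`() x).
Proof.
have h : is_cder (fun s => (p + s%:C *: r)^`().[x%:C]) s r^`().[x%:C].
  under eq_fun do rewrite derivD derivZ.
  exact: cder_line.
have := cderM (cder_dwave (cder_line p r x s)) h.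
by congr is_cder.
Qed.

Lemma ccont_tangent p r x : ccont (tangent p r) x.
Proof. exact: cder_ccont (cder_tangent_x p r x). Qed.

Lemma ccont_phi (T : topologicalType) (P : T -> C) a :
  ccont P a -> ccont (fun t => phi (P t)) a.
Proof.
move=> cP; apply: (@ccont_comp _ _ P phi a cP); apply: differentiable_continuous.
exact/derivable1_diffP/phi_der.
Qed.

Lemma ccont_dphi (T : topologicalType) (P : T -> C) a :
  ccont P a -> ccont (fun t => dphi (P t)) a.
Proof.
move=> cP; apply: (@ccont_comp _ _ P dphi a cP); apply: differentiable_continuous.
exact/derivable1_diffP/dphi_der.
Qed.

Lemma ccont_ddphi (T : topologicalType) (P : T -> C) a :
  ccont P a -> ccont (fun t => ddphi (P t)) a.
Proof. by move=> cP; apply: ccont_comp cP _; exact: ddphi_cont. Qed.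

Lemma ccont_tangent2 p r r' x : ccont (tangent2 p r r') x.
Proof.
have ch u : ccont (fun y : R => u.[y%:C]) x by exact: cder_ccont (cder_horner u x).
apply: ccontM (ch r'); apply: ccontM (ch r); apply: ccont_ddphi (ch p).
Qed.

Lemma wave_C2 p : C1d 2 (fun x => Re (wave p x)) /\ C1d 2 (fun x => Im (wave p x)).
Proof.
have d1 := cder_wave_x p; have d2 := cder_tangent_x p p^`().
have c3 x : ccont (fun x => tangent2 p p^`() p^`() x + tangent p p^`()^`() x) x.
  by apply: ccontD; [exact: ccont_tangent2|exact: ccont_tangent].
have rE : (fun x => 'D_1 (fun x => Re (wave p x)) x) = (fun x => Re (tangent p p^`() x)).
  by apply/funext => x; have [h _] := d1 x; exact: (@derive_val _ _ _ _ _ _ _ h).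
have iE : (fun x => 'D_1 (fun x => Im (wave p x)) x) = (fun x => Im (tangent p p^`() x)).
  by apply/funext => x; have [_ h] := d1 x; exact: (@derive_val _ _ _ _ _ _ _ h).
have rE2 : (fun x => 'D_1 (fun x => Re (tangent p p^`() x)) x) =
    (fun x => Re (tangent2 p p^`() p^`() x + tangent p p^`()^`() x)).
  by apply/funext => x; have [h _] := d2 x; exact: (@derive_val _ _ _ _ _ _ _ h).
have iE2 : (fun x => 'D_1 (fun x => Im (tangent p p^`() x)) x) =
    (fun x => Im (tangent2 p p^`() p^`() x + tangent p p^`()^`() x)).
  by apply/funext => x; have [_ h] := d2 x; exact: (@derive_val _ _ _ _ _ _ _ h).
split.
  split; first by move=> x; have [] := cder_ccont (d1 x).
  split; first by move=> x; have [[]] := d1 x.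
  rewrite rE; split; first by move=> x; have [] := cder_ccont (d2 x).
  split; first by move=> x; have [[]] := d2 x.
  by rewrite rE2; split=> // x; have [] := c3 x.
split; first by move=> x; have [] := cder_ccont (d1 x).
split; first by move=> x; have [_ []] := d1 x.
rewrite iE; split; first by move=> x; have [] := cder_ccont (d2 x).
split; first by move=> x; have [_ []] := d2 x.
by rewrite iE2; split=> // x; have [] := c3 x.
Qed.

End HolomorphicAnsatz.

(** * First variation of the action *)

Section FirstVariation.
Context {R : realType}.
Local Notation C := R[i].
Implicit Types (h : C -> C -> C) (u p v c : C).

Lemma wirtE (f : C -> C) z d1 d2 :
  is_cder (fun s => f (z + s%:C)) 0 d1 ->
  is_cder (fun s => f (z + 'i * s%:C)) 0 d2 ->
  wirt f z = 2^-1 * (d1 - 'i * d2).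
Proof. by move=> h1 h2; rewrite /wirt (cder_val h1) (cder_val h2). Qed.

Lemma cder_translate1 u : is_cder (fun s : R => u + s%:C) 0 1.
Proof.
have := cder_translate u 1; rewrite mul1r.
by under eq_fun do rewrite mul1r.
Qed.

Lemma wirtinger_kinetic v (P Q : C) :
  2^-1 * (2^-1 * ('i * v * 1^* + - ('i * v^*) * 1) + P -
    'i * (2^-1 * ('i * v * ('i * 1)^* + - ('i * v^*) * ('i * 1)) + Q)) =
  - (2^-1 * 'i * v^*) + 2^-1 * (P - 'i * Q).
Proof.
case: v => v1 v2; case: P => P1 P2; case: Q => Q1 Q2.
by rewrite !half_complex; apply: complex_eq => /=; field.
Qed.

Lemma wirt_density_u h u p v : real_Ck 1 h ->
  wirt (fun z => density h z p v) u = - (2^-1 * 'i * v^*) + h_u h u p.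
Proof.
move=> hh; have [e1 e2] := partial_uE u p hh.
have kin (k : R -> C) dk : is_cder k 0 dk ->
    is_cder (fun s => 2^-1 * ('i * v * (k s)^* - 'i * k s * v^*)) 0
      (2^-1 * ('i * v * dk^* + - ('i * v^*) * dk)).
  move=> hk.
  have := cderZ 2^-1 (cderD (cderZ ('i * v) (cderJ hk)) (cderZ (- ('i * v^*)) hk)).
  by congr is_cder; apply/funext => s; rewrite mulNr (mulrAC 'i (v^*)).
have hder (k : R -> C) dk : is_cder k 0 dk ->
    is_cder (fun s => h (k s) p) 0 (cderive (fun s => h (k s) p) 0).
  by move=> hk; have H := cder_wirtinger hh hk (cder_cst p 0); rewrite (cder_val H).
rewrite (wirtE (cderD (kin _ _ (cder_translate1 u)) (hder _ _ (cder_translate1 u)))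
  (cderD (kin _ _ (cder_translate u 'i)) (hder _ _ (cder_translate u 'i)))).
exact: wirtinger_kinetic.
Qed.

Lemma wirt_density_v h u p v :
  wirt (fun z => density h u p z) v = 2^-1 * 'i * u^*.
Proof.
have kin (k : R -> C) dk : is_cder k 0 dk ->
    is_cder (fun s => density h u p (k s)) 0
      (2^-1 * ('i * u^* * dk + - ('i * u) * dk^*) + 0).
  move=> hk.
  have := cderD (cderZ 2^-1 (cderD (cderZ ('i * u^*) hk) (cderZ (- ('i * u)) (cderJ hk))))
    (cder_cst (h u p) 0).
  congr is_cder; apply/funext => s; rewrite /density.
  by congr (_ * (_ + _) + _); rewrite ?mulNr// mulrAC.
rewrite (wirtE (kin _ _ (cder_translate1 v)) (kin _ _ (cder_translate v 'i))).
case: u {kin} => u1 u2.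
by rewrite !half_complex; apply: complex_eq => /=; field.
Qed.

Lemma wirt_density_p h u p v : real_Ck 1 h ->
  wirt (fun z => density h u z v) p = h_p h u p.
Proof.
move=> hh.
have hder (k : R -> C) dk : is_cder k 0 dk ->
    is_cder (fun s => density h u (k s) v) 0 (cderive (fun s => h u (k s)) 0).
  move=> hk; have H := cder_wirtinger hh (cder_cst u 0) hk.
  rewrite -[X in is_cder _ _ X]add0r.
  by apply: cderD (cder_cst _ _) _; rewrite (cder_val H).
by rewrite (wirtE (hder _ _ (cder_translate1 p)) (hder _ _ (cder_translate p 'i))).
Qed.

End FirstVariation.

Section Consistency.
Context {R : realType}.
Local Notation C := R[i].
Variables (h : C -> C -> C) (phi : C -> C).
Hypothesis h_C2 : real_C2 h.
Hypothesis h_conj : forall u p : C, (h_u h u p)^* = h_ubar h u p.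
Hypothesis h_pde : first_variation_is_pde h.
Hypothesis phi_C2 : complex_C2 phi.

Local Notation wave_x p := (tangent phi p p^`()).

Let h2 : real_Ck 2 h := h_C2.
Let h1 : real_Ck 1 h := real_Ck_le h2.

Lemma cder_h_p (p : {poly C}) x :
  is_cder (fun y => h_p h (wave phi p y) (wave_x p y)) x
    (cderive (fun y => h_p h (wave phi p y) (wave_x p y)) x) /\
  is_cder (fun y => h_pbar h (wave phi p y) (wave_x p y)) x
    (cderive (fun y => h_pbar h (wave phi p y) (wave_x p y)) x).
Proof.
have [hp hq] := real_Ck_h_p h2.
have H := cder_wirtinger hp (cder_wave_x phi_C2 p x) (cder_tangent_x phi_C2 p p^`() x).
have K := cder_wirtinger hq (cder_wave_x phi_C2 p x) (cder_tangent_x phi_C2 p p^`() x).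
by rewrite (cder_val H) (cder_val K).
Qed.

Lemma wave_x_val (p : {poly C}) : cderive (wave phi p) = wave_x p.
Proof. by apply/funext => x; exact: cder_val (cder_wave_x phi_C2 p x). Qed.

(** The two Euler-Lagrange equations of the action are tested on the fields
    [wave p x + t * c]. At [t = 0] the velocity is the free constant [c], so the
    equation for [u] holds for [c := F (wave p) x]; conjugating it and comparing with
    the definition of [F] identifies the two fluxes. *)
Lemma flux_conj (p : {poly C}) x :
  cderive (fun y => h_p h (wave phi p y) (wave_x p y)) x =
  (cderive (fun y => h_pbar h (wave phi p y) (wave_x p y)) x)^*.
Proof.
pose c : C := F h (wave phi p) x.
pose w (y s : R) : C := wave phi p y + c * s%:C.
have w_x y s : cderive (fun y => w y s) y = wave_x p y.
  have := cderD (cder_wave_x phi_C2 p y) (cder_cst (c * s%:C) y).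
  by rewrite addr0 => /cder_val.
have w_t y s : cderive (fun s => w y s) s = c.
  have := cderD (cder_cst (wave phi p y) s) (cderZ c (cder_real s)).
  by rewrite add0r mulr1 => /cder_val.
have w_0 y : w y 0 = wave phi p y by rewrite /w mulr0 addr0.
have wC2 : C2_field w.
  have [cr ci] := wave_C2 phi_C2 p.
  have id2 : C1d 2 (@id R).
    have d1 : (fun y : R => 'D_1 (@id R) y) = fun=> 1.
      by apply/funext => y; exact: derive_id.
    have d2 : (fun y : R => 'D_1 (fun=> 1 : R) y) = fun=> 0.
      by apply/funext => y; exact: derive_cst.
    split; first by move=> y; exact: cvg_id.
    split; first by move=> y; exact: derivable_id.
    rewrite d1; split; first by move=> y; exact: cvg_cst.
    split; first by move=> y; exact: derivable_cst.
    by rewrite d2; split=> // y; exact: cvg_cst.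
  split.
    have := Ck_lin 1 (Re c) (Ck_coord (inord 0 : 'I_2) cr) (Ck_coord (inord 1 : 'I_2) id2).
    congr Ck; apply/funext => y; rewrite mul1r (mulrC (Re c)) -Re_real_mul -Re_add.
    by rewrite (mulrC _ c).
  have := Ck_lin 1 (Im c) (Ck_coord (inord 0 : 'I_2) ci) (Ck_coord (inord 1 : 'I_2) id2).
  congr Ck; apply/funext => y; rewrite mul1r (mulrC (Im c)) -Im_real_mul -Im_add.
  by rewrite (mulrC _ c).
have wE s : w x s = wave phi p x + c * s%:C by [].
have w_F : (fun y => w y 0) = wave phi p by apply/funext => y; exact: w_0.
have cF : c = F h (wave phi p) x by [].
clearbody w c.
have [[_ EL] _] := h_pde wC2 x 0.
have {EL} : variation_u h w x 0 = 0.
  by apply: EL; rewrite w_F -cF; exact: w_t.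
have -> : variation_u h w x 0 =
    wirt (fun u => density h u (cderive (fun y => w y 0) x) (cderive (fun s => w x s) 0)) (w x 0)
  - cderive (fun s => wirt (fun v => density h (w x s) (cderive (fun y => w y s) x) v)
      (cderive (fun s => w x s) s)) 0
  - cderive (fun y => wirt (fun q => density h (w y 0) q (cderive (fun s => w y s) 0))
      (cderive (fun y => w y 0) y)) x by [].
rewrite wirt_density_u// w_x w_t w_0.
have -> : (fun s => wirt (fun v => density h (w x s) (cderive (fun y => w y s) x) v)
    (cderive (fun s => w x s) s)) = fun s => 2^-1 * 'i * (w x s)^*.
  by apply/funext => s; rewrite wirt_density_v.
have -> : cderive (fun s => 2^-1 * 'i * (w x s)^*) 0 = 2^-1 * 'i * c^*.
  under eq_fun do rewrite wE.
  have := cderZ (2^-1 * 'i) (cderJ (cderD (cder_cst (wave phi p x) 0) (cderZ c (cder_real 0)))).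
  by rewrite add0r mulr1 => /cder_val.
have -> : (fun y => wirt (fun q => density h (w y 0) q (cderive (fun s => w y s) 0))
      (cderive (fun y => w y 0) y)) =
    fun y => h_p h (wave phi p y) (wave_x p y).
  by apply/funext => y; rewrite wirt_density_p// w_0 w_x.
have cE : c = - 'i * cderive (fun y => h_pbar h (wave phi p y) (wave_x p y)) x +
    'i * h_ubar h (wave phi p x) (wave_x p x) by rewrite cF /F wave_x_val.
rewrite -h_conj in cE.
have alg (D D' P e : C) : e = - 'i * D' + 'i * P^* ->
    - (2^-1 * 'i * e^*) + P - 2^-1 * 'i * e^* - D = 0 -> D = D'^*.
  move=> -> /eqP; rewrite subr_eq0 => /eqP <-.
  case: D' => D1 D2; case: P => P1 P2.
  by rewrite !half_complex; apply: complex_eq => /=; field.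
exact: alg cE.
Qed.

End Consistency.

(** * Derivative of the energy *)

Section EnergyVariation.
Context {R : realType}.
Local Notation C := R[i].
Variables (h : C -> C -> C) (phi : C -> C).
Hypothesis h_C2 : real_C2 h.
Hypothesis h_conj : forall u p : C, (h_u h u p)^* = h_ubar h u p.
Hypothesis h_pde : first_variation_is_pde h.
Hypothesis phi_C2 : complex_C2 phi.
Implicit Types p r : {poly C}.

Local Notation wave_x p := (tangent phi p p^`()).

Let h2 : real_Ck 2 h := h_C2.
Let h1 : real_Ck 1 h := real_Ck_le h2.

Definition tangent_x p r (x : R) : C := tangent2 phi p r p^`() x + tangent phi p r^`() x.

Definition energy_variation p r (x : R) : C :=
  h_u h (wave phi p x) (wave_x p x) * tangent phi p r x +
  h_ubar h (wave phi p x) (wave_x p x) * (tangent phi p r x)^* +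
  (h_p h (wave phi p x) (wave_x p x) * tangent_x p r x +
   h_pbar h (wave phi p x) (wave_x p x) * (tangent_x p r x)^*).

Lemma cder_energy p r x s :
  is_cder (fun s => h (wave phi (p + s%:C *: r) x) (wave_x (p + s%:C *: r) x)) s
    (energy_variation (p + s%:C *: r) r x).
Proof.
exact: (cder_wirtinger h1 (cder_wave_s phi_C2 p r x s) (cder_wave_xs phi_C2 p r x s)).
Qed.

Lemma ccont_tangent_x p r x : ccont (tangent_x p r) x.
Proof. by apply: ccontD; [exact: ccont_tangent2|exact: ccont_tangent]. Qed.

Lemma ccont_energy_variation p r x : ccont (energy_variation p r) x.
Proof.
have [c1 c2 c3 c4] := ccont_wirtinger h1 (cder_wave_x phi_C2 p x)
  (cder_tangent_x phi_C2 p p^`() x).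
have ct := ccont_tangent phi_C2 p r x; have cx := ccont_tangent_x p r x.
apply: ccontD; apply: ccontD.
- exact: ccontM c1 ct.
- exact: ccontM c2 (ccontJ ct).
- exact: ccontM c3 cx.
- exact: ccontM c4 (ccontJ cx).
Qed.

Lemma ccont_flux_x p x :
  ccont (cderive (fun y => h_p h (wave phi p y) (wave_x p y))) x /\
  ccont (cderive (fun y => h_pbar h (wave phi p y) (wave_x p y))) x.
Proof.
have [hp hq] := real_Ck_h_p h2.
have key g : real_Ck 1 g ->
    ccont (cderive (fun y => g (wave phi p y) (wave_x p y))) x.
  move=> hg.
  have -> : cderive (fun y => g (wave phi p y) (wave_x p y)) = fun y =>
      h_u g (wave phi p y) (wave_x p y) * wave_x p y +
      h_ubar g (wave phi p y) (wave_x p y) * (wave_x p y)^* +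
      (h_p g (wave phi p y) (wave_x p y) * tangent_x p p^`() y +
       h_pbar g (wave phi p y) (wave_x p y) * (tangent_x p p^`() y)^*).
    apply/funext => y; apply: cder_val.
    exact: (cder_wirtinger hg (cder_wave_x phi_C2 p y) (cder_tangent_x phi_C2 p p^`() y)).
  have [c1 c2 c3 c4] := ccont_wirtinger hg (cder_wave_x phi_C2 p x)
    (cder_tangent_x phi_C2 p p^`() x).
  have ct := ccont_tangent phi_C2 p p^`() x; have cx := ccont_tangent_x p p^`() x.
  apply: ccontD; apply: ccontD.
  - exact: ccontM c1 ct.
  - exact: ccontM c2 (ccontJ ct).
  - exact: ccontM c3 cx.
  - exact: ccontM c4 (ccontJ cx).
by split; exact: key.
Qed.

(** [D] and [D^*] stand for the two flux derivatives, which are conjugate, and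
    [- 'i * D^* + 'i * P^*] for the value of [F]. *)
Lemma flux_algebra (D P T V X Y : C) :
  D * T + X * V + (D^* * T^* + Y * V^*) =
  P * T + P^* * T^* + (X * V + Y * V^*) -
  ('i * (T * (- 'i * D^* + 'i * P^*)^*) - 'i * (- 'i * D^* + 'i * P^*) * T^*).
Proof.
case: D => D1 D2; case: P => P1 P2; case: T => T1 T2; case: V => V1 V2.
case: X => X1 X2; case: Y => Y1 Y2.
by apply: complex_eq => /=; ring.
Qed.

(** The boundary term of the integration by parts. *)
Definition flux p r (x : R) : C :=
  h_p h (wave phi p x) (wave_x p x) * tangent phi p r x +
  h_pbar h (wave phi p x) (wave_x p x) * (tangent phi p r x)^*.

(** The flux absorbs the terms of the energy variation in which the tangent is
    differentiated in space. What is left pairs the tangent with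
    [h_u - (h_p)_x], and its conjugate with [h_ubar - (h_pbar)_x]; the latter is
    [- 'i * F] by definition and the former its conjugate by [flux_conj]. *)
Lemma cder_flux p r x :
  is_cder (flux p r) x (energy_variation p r x -
   ('i * (tangent phi p r x * (F h (wave phi p) x)^*) -
    'i * F h (wave phi p) x * (tangent phi p r x)^*)).
Proof.
have [dp dq] := cder_h_p h_C2 phi_C2 p x.
have ht := cder_tangent_x phi_C2 p r x.
have := cderD (cderM dp ht) (cderM dq (cderJ ht)).
congr is_cder; rewrite /F wave_x_val// -h_conj.
have e : cderive (fun y => h_pbar h (wave phi p y) (wave_x p y)) x =
    (cderive (fun y => h_p h (wave phi p y) (wave_x p y)) x)^*.
  by rewrite (flux_conj h_C2 h_conj h_pde phi_C2) conjcK.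
rewrite e /energy_variation -h_conj; exact: flux_algebra.
Qed.

(** The derivative of the flux integrates to zero. The remainder is
    ['i * <T, F> - 'i * <F, T>], where the inner products are conjugate. *)
Lemma cintegral_energy_variation p r :
  in_H (F h (wave phi p)) -> in_H (tangent phi p r) ->
  cintegrable (energy_variation p r) ->
  normc (flux p r x) @[x --> +oo] --> (0 : R) ->
  normc (flux p r x) @[x --> -oo] --> (0 : R) ->
  cintegral (energy_variation p r) =
    (- 2 * Im (inner (tangent phi p r) (F h (wave phi p))))%:C.
Proof.
move=> HF HT iE Bp Bn.
have iTF := in_H_inner HT HF; have iFT := in_H_inner HF HT.
pose k x := 'i * (tangent phi p r x * (F h (wave phi p) x)^*) +
    (- 'i) * (F h (wave phi p) x * (tangent phi p r x)^*).
have ik : cintegrable k by apply: cintegrableD; exact: cintegrableZ.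
have db x : is_cder (flux p r) x (energy_variation p r x + (-1) * k x).
  have := cder_flux p r x; congr is_cder; rewrite mulN1r /k mulNr.
  by rewrite (mulrA 'i (F h (wave phi p) x)).
have cb x : ccont (fun x => energy_variation p r x + (-1) * k x) x.
  have [c1 c2] := ccont_flux_x p x.
  have [_ w2 _ _] := ccont_wirtinger h1 (cder_wave_x phi_C2 p x)
    (cder_tangent_x phi_C2 p p^`() x).
  have ct := ccont_tangent phi_C2 p r x.
  have cF : ccont (F h (wave phi p)) x.
    rewrite (_ : F h (wave phi p) = fun x =>
      - 'i * cderive (fun y => h_pbar h (wave phi p y) (wave_x p y)) x +
      'i * h_ubar h (wave phi p x) (wave_x p x)).
      exact: ccontD (ccontM (ccont_cst _ _) c2) (ccontM (ccont_cst _ _) w2).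
    by apply/funext => y; rewrite /F wave_x_val.
  apply: ccontD (ccont_energy_variation p r x) (ccontM (ccont_cst _ _) _).
  apply: ccontD; apply: ccontM (ccont_cst _ _) _.
    exact: ccontM ct (ccontJ cF).
  exact: ccontM cF (ccontJ ct).
have := cintegral_derive_vanishing db cb (cintegrableD iE (cintegrableZ (-1) ik)) Bp Bn.
rewrite cintegralD//; last exact: cintegrableZ.
rewrite cintegralZ// mulN1r => /eqP; rewrite subr_eq0 => /eqP ->.
rewrite cintegralD; [|exact: cintegrableZ..].
rewrite !cintegralZ// -/(inner _ _) -/(inner _ _) (inner_conj HT HF).
move: (inner _ _) => -[a b].
by apply: complex_eq => /=; ring.
Qed.

End EnergyVariation.

(** * Parameters of the ansatz *)

Section ComplexCurves.
Context {R : realType} {n : nat}.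
Local Notation C := R[i].
Implicit Types (f : 'rV[R]_n -> C) (a b : 'rV[R]_n).

Lemma cpartial_val (k : 'I_n) f a d :
  is_cder (fun s => f (s *: delta_mx 0 k + a)) 0 d -> cpartial k f a = d.
Proof.
move=> [hr hi]; apply: complex_eq => /=.
  have := (is_derive_line (fun b => Re (f b)) a (delta_mx 0 k) 0 (Re d)).1 hr.
  by rewrite scale0r add0r => h; exact: (@derive_val _ _ _ _ _ _ _ h).
have := (is_derive_line (fun b => Im (f b)) a (delta_mx 0 k) 0 (Im d)).1 hi.
by rewrite scale0r add0r => h; exact: (@derive_val _ _ _ _ _ _ _ h).
Qed.

Lemma near_eq_continuous (f g : 'rV[R]_n -> R) a :
  (\forall b \near a, f b = g b) -> {for a, continuous f} -> {for a, continuous g}.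
Proof.
move=> fg cf; rewrite /prop_for /continuous_at -(nbhs_singleton fg).
by apply: cvg_trans cf; exact: (near_eq_cvg (F := nbhs a) (FF := nbhs_filter a)).
Qed.

Lemma cder_curve f (df : 'I_n -> 'rV[R]_n -> C) (ga : R -> 'rV[R]_n) (s : R)
    (dga : 'I_n -> R) :
  (\forall b \near ga s, forall i,
     is_cder (fun t => f (t *: delta_mx 0 i + b)) 0 (df i b)) ->
  (forall i, ccont (df i) (ga s)) ->
  (forall i, is_derive s 1 (fun t => ga t 0 i) (dga i)) ->
  is_cder (fun t => f (ga t)) s (\sum_i (dga i)%:C * df i (ga s)).
Proof.
move=> hf cf hg.
have dR b i : is_cder (fun t => f (t *: delta_mx 0 i + b)) 0 (df i b) ->
    is_derive b (delta_mx 0 i : 'rV[R]_n) (fun b => Re (f b)) (Re (df i b)) /\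
    is_derive b (delta_mx 0 i : 'rV[R]_n) (fun b => Im (f b)) (Im (df i b)).
  move=> [hr hi].
  have := (is_derive_line (fun b => Re (f b)) b (delta_mx 0 i) 0 (Re (df i b))).1 hr.
  have := (is_derive_line (fun b => Im (f b)) b (delta_mx 0 i) 0 (Im (df i b))).1 hi.
  by rewrite scale0r add0r.
have hb := nbhs_singleton hf.
split.
  rewrite Re_sum; under eq_bigr do rewrite Re_real_mul.
  under eq_bigr => i _ do rewrite -(@derive_val _ _ _ _ _ _ _ (dR _ i (hb i)).1).
  apply: (is_derive_curve (f := fun b => Re (f b))) => //.
    apply: (@filterS _ _ (nbhs_filter (ga s)) _ _ _ hf) => b h i.
    by have [[]] := dR _ i (h i).
  move=> i; apply: (near_eq_continuous _ (cf i).1).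
  apply: (@filterS _ _ (nbhs_filter (ga s)) _ _ _ hf) => b h.
  exact/esym/(@derive_val _ _ _ _ _ _ _ (dR _ i (h i)).1).
rewrite Im_sum; under eq_bigr do rewrite Im_real_mul.
under eq_bigr => i _ do rewrite -(@derive_val _ _ _ _ _ _ _ (dR _ i (hb i)).2).
apply: (is_derive_curve (f := fun b => Im (f b))) => //.
  apply: (@filterS _ _ (nbhs_filter (ga s)) _ _ _ hf) => b h i.
  by have [_ []] := dR _ i (h i).
move=> i; apply: (near_eq_continuous _ (cf i).2).
apply: (@filterS _ _ (nbhs_filter (ga s)) _ _ _ hf) => b h.
exact/esym/(@derive_val _ _ _ _ _ _ _ (dR _ i (h i)).2).
Qed.

End ComplexCurves.

Section PolynomialAnsatz.
Context {R : realType} {m : nat}.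
Local Notation C := R[i].
Local Notation n := (m.+1 + m.+1)%N.
Implicit Types (q v : 'rV[R]_n) (j k : 'I_n).

Definition direction k : {poly C} :=
  match fintype.split k with inl j => 'X^j | inr j => 'i *: 'X^j end.

Definition phase q : {poly C} := \sum_k (q 0 k)%:C *: direction k.

Lemma direction_lshift (j : 'I_m.+1) : direction (lshift m.+1 j) = 'X^j.
Proof. by rewrite /direction (unsplitK (inl j)). Qed.

Lemma direction_rshift (j : 'I_m.+1) :
  direction (rshift m.+1 j) = 'i *: direction (lshift m.+1 j).
Proof. by rewrite direction_lshift /direction (unsplitK (inr j)). Qed.

Lemma phase_line q k s : phase (s *: delta_mx 0 k + q) = phase q + s%:C *: direction k.
Proof.
rewrite /phase [RHS]addrC (bigD1 k)//= [in RHS](bigD1 k)//= !mxE !eqxx mulr1.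
rewrite rmorphD scalerDl -!addrA; congr (_ + (_ + _)).
by apply: eq_bigr => i /negbTE ik; rewrite !mxE ik mulr0 add0r.
Qed.

Lemma poly_ansatzE (phi : C -> C) : @poly_ansatz R m phi = fun q => wave phi (phase q).
Proof.
apply/funext => q; apply/funext => x; rewrite /poly_ansatz /wave; congr phi.
rewrite /phase big_split_ord/= -big_split/= horner_sum; apply: eq_bigr => j _.
rewrite direction_rshift direction_lshift !hornerD !hornerZ hornerXn rmorphXn/=.
rewrite mulrA -mulrDl; congr (_ * _).
by apply: complex_eq => /=; ring.
Qed.

Lemma ccont_phase q x : ccont (fun q => (phase q).[x%:C]) q.
Proof.
rewrite (_ : (fun q => _) = fun q => \sum_k (q 0 k)%:C * (direction k).[x%:C]).
  apply: ccont_sum => k; apply: ccontM (ccont_cst _ _).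
  by split; [exact: coord_continuous|exact: cst_continuous].
apply/funext => q'; rewrite /phase horner_sum.
by apply: eq_bigr => k _; rewrite hornerZ.
Qed.

End PolynomialAnsatz.

(** * Euler-Lagrange equations of the reduced Lagrangian *)

Section ReducedLagrangian.
Context {R : realType} {m : nat}.
Local Notation C := R[i].
Local Notation n := (m.+1 + m.+1)%N.
Local Notation mu := (@lebesgue_measure R).
Variables (h : C -> C -> C) (phi : C -> C) (Omega : set 'rV[R]_n).
Hypothesis h_C2 : real_C2 h.
Hypothesis h_conj : forall u p : C, (h_u h u p)^* = h_ubar h u p.
Hypothesis h_pde : first_variation_is_pde h.
Hypothesis phi_C2 : complex_C2 phi.
Hypothesis Omega_open : open Omega.
Hypothesis regular : regular_ansatz h (@poly_ansatz R m phi) Omega.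
Implicit Types (q v : 'rV[R]_n) (j k : 'I_n).

Local Notation uhat := (@poly_ansatz R m phi).
Local Notation U q := (wave phi (phase q)).
Local Notation Ux q := (tangent phi (phase q) (phase q)^`()).
Local Notation T k q := (tangent phi (phase q) (direction k)).
Local Notation T2 k j q := (tangent2 phi (phase q) (direction k) (direction j)).
Local Notation EV k q := (energy_variation h phi (phase q) (direction k)).

Let h1 : real_Ck 1 h := real_Ck_le (h_C2 : real_Ck 2 h).

Let line0 q k : phase q + (0 : R)%:C *: direction k = phase q.
Proof. by rewrite scale0r addr0. Qed.

Lemma duE k q : du uhat k q = T k q.
Proof.
apply/funext => x; apply: cpartial_val; rewrite poly_ansatzE.
under eq_fun do rewrite phase_line.
by have := cder_wave_s phi_C2 (phase q) (direction k) x 0; rewrite line0.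
Qed.

Lemma partial_duE j k q x : cpartial j (fun p => du uhat k p x) q = T2 k j q x.
Proof.
apply: cpartial_val; under eq_fun do rewrite duE phase_line.
by have := cder_tangent_s phi_C2 (phase q) (direction j) (direction k) x 0; rewrite line0.
Qed.

Lemma uhat_xE q : cderive (uhat q) = Ux q.
Proof. by rewrite poly_ansatzE; exact: wave_x_val. Qed.

Lemma uhatE q : uhat q = U q.
Proof. by rewrite poly_ansatzE. Qed.

Definition energy q (x : R) : C := h (U q x) (Ux q x).

Lemma cder_energy_line k q x s :
  is_cder (fun s => energy (s *: delta_mx 0 k + q) x) s (EV k (s *: delta_mx 0 k + q) x).
Proof.
rewrite /energy; under eq_fun do rewrite phase_line.
by rewrite phase_line; exact: cder_energy.
Qed.

Lemma partial_energyE k q x :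
  cpartial k (fun p => h (uhat p x) (cderive (uhat p) x)) q = EV k q x.
Proof.
apply: cpartial_val; under eq_fun do rewrite uhat_xE uhatE.
by have := cder_energy_line k q x 0; rewrite scale0r add0r.
Qed.

Lemma near_line (P : set 'rV[R]_n) q v :
  (\forall b \near q, P b) -> \forall s \near (0 : R), P (s *: v + q).
Proof.
have cl : {for (0 : R), continuous (fun s : R => s *: v + q)}.
  apply: (curve_continuous (dga := fun i => v 0 i)) => i.
  under eq_fun do rewrite !mxE.
  apply: is_derive_eq; rewrite /GRing.scale/= !mulr1 mulr0 addr0 add0r//.
by move=> hP; apply: cl; rewrite scale0r add0r.
Qed.

Definition dominated (g : R -> R) q : Prop :=
  [/\ Omega q,
      (forall x, normc (U q x) ^+ 2 <= g x) /\
      (forall k x, normc (T k q x) ^+ 2 <= g x),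
      forall k j x, normc (T2 k j q x) ^+ 2 <= g x,
      forall x, normc (energy q x) <= g x &
      forall k x, normc (EV k q x) <= g x].

Lemma local_domination q0 : Omega q0 ->
  exists g : R -> R, mu.-integrable setT (EFin \o g) /\ \forall q \near q0, dominated g q.
Proof.
move=> O0; have [_ /(_ q0 O0)[g [ig hg]] _ _] := regular.
exists g; split=> //.
have := open_nbhs_nbhs (conj Omega_open O0).
apply: (@filterS2 _ _ (nbhs_filter q0) _ _ _ _ hg) => q H Oq; split=> //.
- split=> [x|k x]; have [b1 b2 _ _ _] := H x; first by rewrite -uhatE.
  by rewrite -duE.
- by move=> k j x; have [_ _ b _ _] := H x; rewrite -partial_duE.
- by move=> x; have [_ _ _ b _] := H x; rewrite /energy -uhat_xE -uhatE.
- by move=> k x; have [_ _ _ _ b] := H x; rewrite -partial_energyE.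
Qed.

Lemma dominated_in_H g q : mu.-integrable setT (EFin \o g) -> dominated g q ->
  [/\ in_H (U q), forall k, in_H (T k q), forall k j, in_H (T2 k j q),
      cintegrable (energy q) & forall k, cintegrable (EV k q)].
Proof.
move=> ig [Oq [b1 b2] b3 b4 b5]; split=> [|k|k j||k].
- apply: in_H_dominated ig b1; apply: ccont_measurable => x.
  exact: cder_ccont (cder_wave_x phi_C2 _ x).
- apply: in_H_dominated ig (b2 k); apply: ccont_measurable => x.
  exact: ccont_tangent.
- apply: in_H_dominated ig (b3 k j); apply: ccont_measurable => x.
  exact: ccont_tangent2.
- apply: cintegrable_dominated ig b4; apply: ccont_measurable => x.
  exact: cder_ccont (cder_wirtinger h1 (cder_wave_x phi_C2 _ x)
    (cder_tangent_x phi_C2 _ _ x)).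
- apply: cintegrable_dominated ig (b5 k); apply: ccont_measurable => x.
  exact: ccont_energy_variation.
Qed.

Lemma Omega_in_H q : Omega q ->
  [/\ in_H (U q), forall k, in_H (T k q), forall k j, in_H (T2 k j q),
      cintegrable (energy q) & forall k, cintegrable (EV k q)].
Proof.
move=> Oq; have [g [ig /nbhs_singleton hg]] := local_domination Oq.
exact: dominated_in_H ig hg.
Qed.

Lemma F_in_H q : Omega q -> in_H (F h (U q)).
Proof. by move=> Oq; have [/(_ q Oq)[_ +] _ _ _] := regular; rewrite uhatE. Qed.

Let half_i : C := 2^-1 * 'i.

(** The density of the Lagrangian is affine in the velocity; [kinetic j] is the
    coefficient of its [j]-th component. *)
Definition kinetic j q (x : R) : C :=
  half_i * (T j q x * (U q x)^*) - half_i * (U q x * (T j q x)^*).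

Definition kinetic_diff k j q (x : R) : C :=
  half_i * (T2 j k q x * (U q x)^* + T j q x * (T k q x)^*) -
  half_i * (T k q x * (T j q x)^* + U q x * (T2 j k q x)^*).

Lemma cder_kinetic k j q x s :
  is_cder (fun s => kinetic j (s *: delta_mx 0 k + q) x) s
    (kinetic_diff k j (s *: delta_mx 0 k + q) x).
Proof.
have hU := cder_wave_s phi_C2 (phase q) (direction k) x s.
have hT := cder_tangent_s phi_C2 (phase q) (direction k) (direction j) x s.
have := cderD (cderZ half_i (cderM hT (cderJ hU))) (cderZ (- half_i) (cderM hU (cderJ hT))).
rewrite /kinetic /kinetic_diff; under [X in _ -> is_cder X _ _]eq_fun do rewrite phase_line -mulNr.
by rewrite phase_line -[- (half_i * _)]mulNr.
Qed.

Lemma normc_half_i_mul (x y : C) (g : R) : normc x ^+ 2 <= g -> normc y ^+ 2 <= g ->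
  normc (half_i * (x * y^*)) <= g.
Proof.
move=> xg yg; rewrite ComplexField.Normc.normcM.
have -> : normc half_i = 2^-1.
  have : normc half_i ^+ 2 = 2^-1 ^+ 2.
    by rewrite normc_sqr /half_i half_complex /=; field.
  by move/eqP; rewrite eqrXn2// ?normc_ge0 ?invr_ge0// => /eqP.
rewrite ler_pdivrMl// (le_trans (normcM_le _ _))// normcJ_eq; lra.
Qed.

Lemma normcD_le (x y : C) (a b : R) :
  normc x <= a -> normc y <= b -> normc (x + y) <= a + b.
Proof. by move=> xa yb; rewrite (le_trans (le_normcD _ _))// lerD. Qed.

Lemma kinetic_diff_dominated g q k j : dominated g q ->
  forall x, normc (kinetic_diff k j q x) <= 4 * g x.
Proof.
move=> [_ [b1 b2] b3 _ _] x.
rewrite /kinetic_diff !mulrDr opprD.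
rewrite (_ : 4 * g x = (g x + g x) + (g x + g x)); last by ring.
do 2 apply: normcD_le; rewrite ?normcN; exact: normc_half_i_mul.
Qed.

Lemma ccont_kinetic_diff k j q : (forall x, ccont (kinetic_diff k j q) x) /\
  (forall x, ccont (fun q => kinetic_diff k j q x) q).
Proof.
split=> x; rewrite /kinetic_diff; under eq_fun do rewrite -mulNr.
  have cU : ccont (U q) x by exact: cder_ccont (cder_wave_x phi_C2 _ x).
  have cT (l : 'I_n) : ccont (T l q) x by exact: ccont_tangent.
  have cT2 : ccont (T2 j k q) x by exact: ccont_tangent2.
  apply: ccontD; apply: ccontM (ccont_cst _ _) _.
    exact: (ccontD (ccontM cT2 (ccontJ cU)) (ccontM (cT j) (ccontJ (cT k)))).
  exact: (ccontD (ccontM (cT k) (ccontJ (cT j))) (ccontM cU (ccontJ cT2))).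
have cU : ccont (fun q => U q x) q by exact: ccont_phi (ccont_phase q x).
have cT (l : 'I_n) : ccont (fun q => T l q x) q.
  by apply: ccontM (ccont_cst _ _); exact: ccont_dphi (ccont_phase q x).
have cT2 : ccont (fun q => T2 j k q x) q.
  apply: ccontM (ccont_cst _ _); apply: ccontM (ccont_cst _ _).
  exact: ccont_ddphi (ccont_phase q x).
apply: ccontD; apply: ccontM (ccont_cst _ _) _.
  exact: (ccontD (ccontM cT2 (ccontJ cU)) (ccontM (cT j) (ccontJ (cT k)))).
exact: (ccontD (ccontM (cT k) (ccontJ (cT j))) (ccontM cU (ccontJ cT2))).
Qed.

Definition momentum j q : C := cintegral (kinetic j q).

Lemma kinetic_integrable g q j :
  mu.-integrable setT (EFin \o g) -> dominated g q -> cintegrable (kinetic j q).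
Proof.
move=> ig /(dominated_in_H ig)[HU HT _ _ _].
rewrite /kinetic; under eq_fun do rewrite -mulNr.
by apply: cintegrableD; apply: cintegrableZ; exact: in_H_inner.
Qed.

Lemma cder_momentum k j q : Omega q ->
  is_cder (fun s => momentum j (s *: delta_mx 0 k + q)) 0
    (cintegral (kinetic_diff k j q)).
Proof.
move=> Oq; have [g [ig hg]] := local_domination Oq.
have := @cder_cintegral _ (fun s x => kinetic j (s *: delta_mx 0 k + q) x)
  (fun s x => kinetic_diff k j (s *: delta_mx 0 k + q) x) 0 _
  (integrableZ_real 4 ig).
rewrite scale0r add0r; apply.
apply: filterS (near_line (delta_mx 0 k) hg) => s hs; split.
- exact: kinetic_integrable ig hs.
- by move=> x; exact: cder_kinetic.
- exact: kinetic_diff_dominated.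
Qed.

Lemma ccont_momentum_diff k j q : Omega q ->
  ccont (fun q => cintegral (kinetic_diff k j q)) q.
Proof.
move=> Oq; have [g [ig hg]] := local_domination Oq.
apply: (ccont_cintegral (integrableZ_real 4 ig)); last first.
  by move=> x; have [_] := ccont_kinetic_diff k j q; exact.
apply: (@filterS _ _ (nbhs_filter q) _ _ _ hg) => b hb; split.
  by apply: ccont_measurable; have [] := ccont_kinetic_diff k j b.
exact: kinetic_diff_dominated.
Qed.

Lemma cder_energy_integral k q : Omega q ->
  is_cder (fun s => cintegral (energy (s *: delta_mx 0 k + q))) 0 (cintegral (EV k q)).
Proof.
move=> Oq; have [g [ig hg]] := local_domination Oq.
have := @cder_cintegral _ (fun s x => energy (s *: delta_mx 0 k + q) x)
  (fun s x => EV k (s *: delta_mx 0 k + q) x) 0 _ ig.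
rewrite scale0r add0r; apply.
apply: filterS (near_line (delta_mx 0 k) hg) => s hs; split.
- by have [] := dominated_in_H ig hs.
- by move=> x; exact: cder_energy_line.
- by have [_ _ _ _ b] := hs; exact: b.
Qed.

(** Being affine in the velocity, the Lagrangian has velocity derivatives that are
    functions of the position alone. This is why the Euler-Lagrange equations make sense
    along a curve that is differentiable only once. *)
Lemma reduced_lagrangianE q v : Omega q ->
  reduced_lagrangian h uhat q v =
  \sum_j (v 0 j)%:C * momentum j q + cintegral (energy q).
Proof.
move=> Oq; have [g [ig /nbhs_singleton hg]] := local_domination Oq.
have [HU HT _ iE _] := dominated_in_H ig hg.
have ik j : cintegrable (fun x => (v 0 j)%:C * kinetic j q x).
  by apply: cintegrableZ; exact: kinetic_integrable ig hg.
have [is_ sE] := cintegral_sum (index_enum 'I_n) ik.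
rewrite /momentum; under eq_bigr => j _ do
  rewrite -(cintegralZ (v 0 j)%:C (kinetic_integrable j ig hg)).
rewrite -sE -cintegralD//; congr cintegral; apply/funext => x.
rewrite uhat_xE uhatE /density; congr (_ + _).
rewrite /uhat_t rmorph_sum/= !mulr_sumr mulr_suml -sumrB mulr_sumr.
apply: eq_bigr => j _; rewrite duE /kinetic.
move: (U q x) (T j q x) => [a b] [c d].
by rewrite /half_i !half_complex; apply: complex_eq => /=; ring.
Qed.

Lemma partial_velocity k q v : Omega q ->
  cpartial k (fun v => reduced_lagrangian h uhat q v) v = momentum k q.
Proof.
move=> Oq; apply: cpartial_val.
have := cderD (cderZr (momentum k q) (cder_real 0))
  (cder_cst (reduced_lagrangian h uhat q v) 0).
rewrite mul1r addr0; congr is_cder; apply/funext => s.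
rewrite !reduced_lagrangianE// addrA; congr (_ + _).
rewrite (bigD1 k)//= [in RHS](bigD1 k)//= !mxE !eqxx mulr1 rmorphD mulrDl.
rewrite -!addrA; congr (_ + (_ + _)).
by apply: eq_bigr => i /negbTE ik; rewrite !mxE ik mulr0 add0r.
Qed.

Lemma partial_position k q v : Omega q ->
  cpartial k (fun q => reduced_lagrangian h uhat q v) q =
  \sum_j (v 0 j)%:C * cintegral (kinetic_diff k j q) + cintegral (EV k q).
Proof.
move=> Oq; apply: cpartial_val.
have := cderD (cder_sum (index_enum 'I_n)
    (fun j => cderZ (v 0 j)%:C (cder_momentum k j Oq))) (cder_energy_integral k Oq).
apply: cder_near_eq; have [g [ig hg]] := local_domination Oq.
apply: filterS (near_line (delta_mx 0 k) hg) => s [Os _ _ _ _].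
by rewrite reduced_lagrangianE.
Qed.

(** The second derivatives [T2] are symmetric in the two directions and cancel. *)
Lemma kinetic_diff_antisym k j q : Omega q ->
  cintegral (kinetic_diff k j q) - cintegral (kinetic_diff j k q) =
  (2 * Im (inner (T k q) (T j q)))%:C.
Proof.
move=> Oq; have [HU HT HT2 _ _] := Omega_in_H Oq.
have E k' j' : cintegral (kinetic_diff k' j' q) =
    half_i * (inner (T2 j' k' q) (U q) + inner (T j' q) (T k' q)) -
    half_i * (inner (T k' q) (T j' q) + inner (U q) (T2 j' k' q)).
  rewrite /kinetic_diff; under [X in cintegral X]eq_fun do rewrite -mulNr.
  have iD f1 f2 g1 g2 : in_H f1 -> in_H g1 -> in_H f2 -> in_H g2 ->
      cintegrable (fun x : R => f1 x * (g1 x)^* + f2 x * (g2 x)^*).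
    by move=> *; apply: cintegrableD; exact: in_H_inner.
  rewrite cintegralD; [|by apply: cintegrableZ; exact: iD..].
  rewrite !cintegralZ; [|exact: iD..].
  by rewrite !cintegralD ?mulNr; [|exact: in_H_inner..].
rewrite !E.
have -> : T2 j k q = T2 k j q by apply/funext => x; exact: mulrAC.
rewrite (inner_conj (HT k) (HT j)).
move: (inner (T k q) (T j q)) (inner _ (U q)) (inner (U q) _) => [a b] [c d] [e f].
by rewrite /half_i !half_complex; apply: complex_eq => /=; field.
Qed.

Lemma cintegral_energy_variationE k q : Omega q ->
  cintegral (EV k q) = (- 2 * Im (inner (T k q) (F h (U q))))%:C.
Proof.
move=> Oq; have [_ HT _ _ iEV] := Omega_in_H Oq.
have [_ _ /(_ q k Oq) B1 /(_ q k Oq) B2] := regular.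
have key (G : set_system R) (FG : Filter G) (b1 b2 : R -> C) :
    normc (b1 x) @[x --> G] --> (0 : R) -> normc (b2 x) @[x --> G] --> (0 : R) ->
    normc (b1 x + b2 x) @[x --> G] --> (0 : R).
  move=> c1 c2; apply: (@squeeze_cvgr _ _ _ _ (fun=> 0) (fun x => normc (b1 x) + normc (b2 x))).
  - by apply: nearW => x; rewrite normc_ge0 le_normcD.
  - exact: cvg_cst.
  - by rewrite -[X in _ --> X]addr0; exact: cvgD.
move: B1 B2; rewrite uhat_xE uhatE duE => -[p1 n1] [p2 n2].
by apply: cintegral_energy_variation => //; [exact: F_in_H|exact: key|exact: key].
Qed.

(** [residual q v k] is the inner product of the [k]-th tangent vector with
    [uhat_t - F uhat]. *)
Definition residual q v k : C :=
  \sum_j (v 0 j)%:C * inner (T k q) (T j q) - inner (T k q) (F h (U q)).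

(** The left-hand side of the [k]-th equation is [2 * Im (residual (q t) v k)]: the
    kinetic part contributes the metric, by antisymmetry, and the energy the
    pairing with [F]. *)
Lemma euler_lagrange_residual (q : R -> 'rV[R]_n) t :
  Omega (q t) -> derivable q t 1 ->
  euler_lagrange h uhat q t <->
  forall k, Im (residual (q t) (derive1 q t) k) = 0.
Proof.
move=> Ot dq; set v := derive1 q t.
have dqi i : is_derive t 1 (fun s => q s 0 i) (v 0 i).
  apply: DeriveDef; first by have /derivable_mxP := dq; exact.
  by rewrite /v derive1E derive_mx// mxE.
have nearO : \forall s \near t, Omega (q s).
  by have := curve_continuous dqi; apply; exact: open_nbhs_nbhs.
have time k : cderive (fun s => cpartial k
      (fun v => reduced_lagrangian h uhat (q s) v) (derive1 q s)) t =
    \sum_j (v 0 j)%:C * cintegral (kinetic_diff j k (q t)).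
  apply: cder_val; apply: (@cder_near_eq _ (fun s => momentum k (q s))).
    by apply: filterS nearO => s Os; rewrite partial_velocity.
  apply: (cder_curve (f := momentum k)
    (df := fun j q => cintegral (kinetic_diff j k q))) => //.
    have := open_nbhs_nbhs (conj Omega_open Ot).
    apply: (@filterS _ _ (nbhs_filter (q t))) => b Ob j.
    exact: cder_momentum.
  by move=> j; exact: ccont_momentum_diff.
have EL k : cpartial k (fun a => reduced_lagrangian h uhat a v) (q t) -
    cderive (fun s => cpartial k
      (fun v => reduced_lagrangian h uhat (q s) v) (derive1 q s)) t =
    (2 * Im (residual (q t) v k))%:C.
  rewrite time partial_position// cintegral_energy_variationE// addrAC -sumrB.
  under eq_bigr => j _ do rewrite -mulrBr kinetic_diff_antisym//.
  rewrite /residual Im_add Im_opp Im_sum.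
  apply: complex_eq; rewrite ?Re_add ?Im_add ?Re_sum ?Im_sum /=.
    rewrite mulrBr mulr_sumr mulNr; congr (_ + _); apply: eq_bigr => j _.
    by rewrite /=; ring.
  by rewrite addr0 big1// => j _ /=; ring.
split=> [H k|H k].
  by have := H k; rewrite EL => -[/eqP]; rewrite mulf_eq0 pnatr_eq0/= => /eqP.
by rewrite EL H mulr0.
Qed.

End ReducedLagrangian.

(** * Least squares *)

Section LeastSquares.
Context {R : realType} {n : nat}.
Local Notation C := R[i].
Implicit Types (f g : R -> C) (v w : 'rV[R]_n) (k : 'I_n).

Lemma innerDr (e f g : R -> C) : in_H e -> in_H f -> in_H g ->
  inner e (fun x => f x + g x) = inner e f + inner e g.
Proof.
move=> He Hf Hg; rewrite (inner_conj (in_HD Hf Hg) He) innerDl//.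
by rewrite (inner_conj Hf He) (inner_conj Hg He) -rmorphD.
Qed.

Lemma innerNr f g : in_H f -> in_H g -> inner g (fun x => - f x) = - inner g f.
Proof.
move=> Hf Hg; have Hn := in_HN Hf.
rewrite (inner_conj Hn Hg) (inner_conj Hf Hg) -rmorphN; congr (_^*).
rewrite -mulN1r -innerZl//; congr (inner _ g); apply/funext => x.
by rewrite mulN1r.
Qed.

Lemma Re_inner_add f g : in_H f -> in_H g ->
  Re (inner (fun x => f x + g x) (fun x => f x + g x)) =
  Re (inner f f) + 2 * Re (inner g f) + Re (inner g g).
Proof.
move=> Hf Hg; have Hfg := in_HD Hf Hg.
rewrite innerDl// !innerDr// (inner_conj Hg Hf) !Re_add Re_conjc; ring.
Qed.

Variables (T : 'I_n -> R -> C) (G : R -> C).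
Hypotheses (HT : forall k, in_H (T k)) (HG : in_H G).

Let W v (x : R) : C := \sum_k T k x * (v 0 k)%:C.
Let D v (x : R) : C := W v x - G x.

Let Wterm v k : (fun x => T k x * (v 0 k)%:C) = (fun x => (v 0 k)%:C * T k x).
Proof. by apply/funext => x; rewrite mulrC. Qed.

Let HW v : in_H (W v).
Proof. by apply: in_H_sum => k; rewrite Wterm; exact: in_HZ. Qed.

Let HD v : in_H (D v).
Proof. by apply: in_HD => //; exact: in_HN. Qed.

Lemma inner_combination k v :
  inner (T k) (D v) = \sum_j (v 0 j)%:C * inner (T k) (T j) - inner (T k) G.
Proof.
have HNG := in_HN HG.
rewrite innerDr// innerNr//; congr (_ - _).
rewrite (inner_conj (HW v) (HT k)) inner_suml//; last first.
  by move=> j; rewrite Wterm; exact: in_HZ.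
rewrite rmorph_sum; apply: eq_bigr => j _.
rewrite Wterm innerZl// (inner_conj (HT j) (HT k)) rmorphM; congr (_ * _).
exact: conjc_real.
Qed.

Lemma combination_shift v w : D w = fun x => D v x + W (w - v) x.
Proof.
apply/funext => x; rewrite /D addrAC; congr (_ - _).
rewrite /W -big_split/=; apply: eq_bigr => k _.
by rewrite -mulrDr -rmorphD !mxE subrKC.
Qed.

(** Normal equations: the error is a convex quadratic function of the
    coefficients, whose derivative at [v] along the [k]-th one is
    [2 * Re (inner (T k) (D v))]. *)
Lemma least_squares v :
  (forall w, Re (inner (D v) (D v)) <= Re (inner (D w) (D w))) <->
  (forall k, Re (inner (T k) (D v)) = 0).
Proof.
split=> [vmin k|orth w].
  set b := Re (inner (T k) (D v)); set a := Re (inner (T k) (T k)).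
  have a0 : 0 <= a by exact: inner_self_ge0.
  have E (c : R) : 0 <= 2 * (c * b) + c ^+ 2 * a.
    have := vmin (v + c *: delta_mx 0 k); rewrite (combination_shift v (v + c *: delta_mx 0 k)) Re_inner_add//.
    have -> : W (v + c *: delta_mx 0 k - v) = fun x => c%:C * T k x.
      apply/funext => x; rewrite /W (bigD1 k)//= addrAC subrr add0r !mxE !eqxx mulr1.
      rewrite big1 ?addr0 ?(mulrC _ (T k x))// => i /negbTE ik.
      by rewrite !mxE ik mulr0 mulr0.
    have HcT : in_H (fun x => c%:C * T k x) by exact: in_HZ.
    rewrite innerZl// innerZl// (inner_conj HcT (HT k)) innerZl//.
    rewrite !Re_real_mul Re_conjc Re_real_mul -/a -/b.
    by rewrite -addrA lerDl expr2 -(mulrA c c a).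
  have a1 : 0 < a + 1 by rewrite ltr_pwDr.
  (* Near the vertex [- b / a] of the parabola [E]; the shift covers [a = 0]. *)
  have := E (- b / (a + 1)).
  have -> : 2 * (- b / (a + 1) * b) + (- b / (a + 1)) ^+ 2 * a =
      - (b / (a + 1)) ^+ 2 * (a + 2) by field; rewrite gt_eqF.
  rewrite mulNr oppr_ge0 => h.
  have a2 : 0 < a + 2 by rewrite ltr_wpDl.
  have : (b / (a + 1)) ^+ 2 <= 0 by rewrite -(pmulr_lle0 _ a2).
  rewrite le_eqVlt ltNge sqr_ge0 orbF sqrf_eq0 mulf_eq0 invr_eq0 (gt_eqF a1) orbF.
  by move/eqP.
rewrite (combination_shift v w) Re_inner_add//.
suff -> : Re (inner (W (w - v)) (D v)) = 0.
  by rewrite mulr0 addr0 lerDl inner_self_ge0.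
rewrite inner_suml//; last by move=> k; rewrite Wterm; exact: in_HZ.
rewrite Re_sum big1// => k _.
by rewrite Wterm innerZl// Re_real_mul orth mulr0.
Qed.

End LeastSquares.

Lemma posdef_unitmx {R : realType} n (A : 'M[R]_n) :
  (forall v : 'rV[R]_n, v != 0 -> 0 < (v *m A *m v^T) 0 0) -> A \in unitmx.
Proof.
move=> pd; rewrite -row_free_unit -kermx_eq0; apply/rowV0P => v /sub_kermxP vA.
by apply: contrapT => /eqP /pd; rewrite vA mul0mx mxE ltxx.
Qed.

(** * Equivalence of the reduced-order equations *)

Section Rons.
Context {R : realType} {m : nat}.
Local Notation C := R[i].
Local Notation n := (m.+1 + m.+1)%N.
Variables (h : C -> C -> C) (phi : C -> C) (Omega : set 'rV[R]_n).
Hypothesis h_C2 : real_C2 h.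
Hypothesis phi_C2 : complex_C2 phi.
Hypothesis Omega_open : open Omega.
Hypothesis regular : regular_ansatz h (@poly_ansatz R m phi) Omega.
Implicit Types (q v : 'rV[R]_n) (j k : 'I_n).

Local Notation uhat := (@poly_ansatz R m phi).
Local Notation T k q := (tangent phi (phase q) (direction k)).

Lemma defectE q v :
  (fun x => uhat_t uhat q v x - F h (uhat q) x) =
  (fun x => \sum_k T k q x * (v 0 k)%:C - F h (wave phi (phase q)) x).
Proof.
apply/funext => x; rewrite uhatE /uhat_t; congr (_ - _).
by apply: eq_bigr => j _; rewrite duE.
Qed.

Lemma residualE q v k : Omega q ->
  residual h phi q v k = inner (T k q)
    (fun x => \sum_k T k q x * (v 0 k)%:C - F h (wave phi (phase q)) x).
Proof.
move=> Oq; have [HU HT _ _ _] := Omega_in_H h_C2 phi_C2 Omega_open regular Oq.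
exact: esym (inner_combination HT (F_in_H regular Oq) k v).
Qed.

Lemma rons_minimizer_residual q v : Omega q ->
  rons_minimizer h uhat q v <-> forall k, Re (residual h phi q v k) = 0.
Proof.
move=> Oq; have [HU HT _ _ _] := Omega_in_H h_C2 phi_C2 Omega_open regular Oq.
have HF := F_in_H regular Oq.
have E w : error h uhat q w = 2^-1 * Re (inner
    (fun x => \sum_k T k q x * (w 0 k)%:C - F h (wave phi (phase q)) x)
    (fun x => \sum_k T k q x * (w 0 k)%:C - F h (wave phi (phase q)) x)).
  apply: etrans (congr1 (fun f => 2^-1 * normH f ^+ 2) (defectE q w)) _.
  by congr (_ * _); exact: sqr_sqrtr (inner_self_ge0 _).
rewrite /rons_minimizer.
have [LS1 LS2] := least_squares HT HF v.
split=> [H k|H w].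
  apply: etrans (congr1 (@Re R) (residualE v k Oq)) _; apply: LS1 => w.
  by have := H w; rewrite !E ler_pM2l// invr_gt0.
rewrite !E ler_pM2l ?invr_gt0//; apply: LS2 => k.
exact: etrans (congr1 (@Re R) (esym (residualE v k Oq))) (H k).
Qed.

Lemma rons_equation_residual q v : Omega q -> metric_posdef uhat Omega ->
  rons_equation h uhat q v <-> forall k, Re (residual h phi q v k) = 0.
Proof.
move=> Oq pd; have uA := posdef_unitmx (pd q Oq).
set A := map_mx _ _ in uA.
have resE k : Re (residual h phi q v k) =
    (A *m v^T) k 0 - map_mx (@Re R) (rhs h uhat q) k 0.
  rewrite /residual Re_add Re_opp Re_sum !mxE uhatE (duE phi_C2); congr (_ - _).
  by apply: eq_bigr => j _; rewrite !mxE Re_real_mul !(duE phi_C2) mulrC.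
rewrite /rons_equation -/A; split=> [vE k|H].
  by rewrite resE vE mulKVmx// subrr.
apply: (canRL (mulKmx uA)); apply/colP => k; apply/eqP.
by rewrite -subr_eq0 -resE H.
Qed.

(** The tangent space is stable under multiplication by ['i], which exchanges
    real and imaginary parts of the residuals. *)
Lemma residual_rshift q v (j : 'I_m.+1) : Omega q ->
  residual h phi q v (rshift m.+1 j) = 'i * residual h phi q v (lshift m.+1 j).
Proof.
move=> Oq; have [HU HT _ _ _] := Omega_in_H h_C2 phi_C2 Omega_open regular Oq.
have HF := F_in_H regular Oq.
have Ti : T (rshift m.+1 j) q = fun x => 'i * T (lshift m.+1 j) q x.
  by apply/funext => x; rewrite direction_rshift /tangent hornerZ mulrCA.
rewrite /residual Ti mulrBr innerZl//; congr (_ - _).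
by rewrite mulr_sumr; apply: eq_bigr => k _; rewrite innerZl// mulrCA.
Qed.

Lemma residual_Re_Im q v : Omega q ->
  (forall k, Im (residual h phi q v k) = 0) <-> (forall k, Re (residual h phi q v k) = 0).
Proof.
move=> Oq.
have Re_i (z : C) : Re ('i * z) = - Im z by rewrite Re_mul /=; ring.
have Im_i (z : C) : Im ('i * z) = Re z by rewrite Im_mul /=; ring.
split=> H k; case: (split_ordP k) => j ->.
- by rewrite -Im_i -residual_rshift.
- by rewrite residual_rshift// Re_i H oppr0.
- by rewrite -[LHS]opprK -Re_i -residual_rshift// H oppr0.
- by rewrite residual_rshift// Im_i.
Qed.

End Rons.

Theorem corollary1 (R : realType) (m : nat)
    (h : R[i] -> R[i] -> R[i]) (phi : R[i] -> R[i])
    (Omega : set 'rV[R]_(m.+1 + m.+1))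
    (h_smooth : real_C2 h)
    (h_conj : forall u p : R[i], (h_u h u p)^* = h_ubar h u p)
    (h_pde : first_variation_is_pde h)
    (phi_smooth : complex_C2 phi)
    (Omega_open : open Omega)
    (ansatz_regular : regular_ansatz h (@poly_ansatz R m phi) Omega)
    (M_posdef : metric_posdef (@poly_ansatz R m phi) Omega)
    (q : R -> 'rV[R]_(m.+1 + m.+1))
    (q_Omega : forall t : R, 0 <= t -> Omega (q t))
    (q_derivable : forall t : R, 0 <= t -> derivable q t 1)
    (t : R) (t_ge0 : 0 <= t) :
  (euler_lagrange h (@poly_ansatz R m phi) q t <->
     rons_equation h (@poly_ansatz R m phi) (q t) (derive1 q t)) /\
  (rons_minimizer h (@poly_ansatz R m phi) (q t) (derive1 q t) <->
     rons_equation h (@poly_ansatz R m phi) (q t) (derive1 q t)).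
Proof.
have Oq := q_Omega t t_ge0.
have rons : rons_equation h (@poly_ansatz R m phi) (q t) (derive1 q t) <->
    forall k, Re (residual h phi (q t) (derive1 q t) k) = 0.
  exact: rons_equation_residual Oq M_posdef.
split; apply: iff_trans _ (iff_sym rons).
  apply: iff_trans (euler_lagrange_residual h_smooth h_conj h_pde phi_smooth
    Omega_open ansatz_regular Oq (q_derivable t t_ge0)) _.
  by apply: (residual_Re_Im h_smooth phi_smooth Omega_open ansatz_regular).
by apply: (rons_minimizer_residual h_smooth phi_smooth Omega_open ansatz_regular).
Qed.
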